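(* Let $\lambda_1,\lambda_2\in\mathbb{C}$ with $\lambda_1,\lambda_2,\lambda_1+\lambda_2\notin\frac12\mathbb{Z}_{\ge0}$. For $\lambda\in\lambda_1+\lambda_2-\mathbb{Z}_{\ge0}$ let $\psi_\lambda:M_\lambda\hookrightarrow M_{\lambda_1}\otimes M_{\lambda_2}$ be the embedding with the $q3j$-symbols $\begin{bmatrix}\lambda_1&\lambda_2&\lambda\\ a_1&a_2&a\end{bmatrix}^\psi_q$ as matrix coefficients and let $\pi_\lambda:M_{\lambda_1}\otimes M_{\lambda_2}\to M_\lambda$ be the linear map $\pi_\lambda(e^{\lambda_1}_{a_1}\otimes e^{\lambda_2}_{a_2})=\begin{bmatrix}\lambda_1&\lambda_2&\lambda\\ a_1&a_2&a_1+a_2\end{bmatrix}^\pi_qe^\lambda_{a_1+a_2}$ (equal to $0$ if $a_1+a_2\notin\lambda-\mathbb{Z}_{\ge0}$). Then $\pi_\lambda$ is $U_q(\mathfrak{sl}_2)$-invariant (a module homomorphism) and $$\pi_\lambda\circ\psi_\lambda=\mathrm{Id}_{M_\lambda},\qquad\sum_\lambda\psi_\lambda\circ\pi_\lambda=\mathrm{Id}_{M_{\lambda_1}\otimes M_{\lambda_2}},$$ the sum being over $\lambda\in\lambda_1+\lambda_2-\mathbb{Z}_{\ge0}$. Explicitly, for $\lambda,\lambda'\in\lambda_1+\lambda_2-\mathbb{Z}_{\ge0}$, $a\in\lambda-\mathbb{Z}_{\ge0}$, $a'\in\lambda'-\mathbb{Z}_{\ge0}$, $$\sum_{a_1,a_2}\begin{bmatrix}\lambda_1&\lambda_2&\lambda\\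 a_1&a_2&a\end{bmatrix}^\pi_q\begin{bmatrix}\lambda_1&\lambda_2&\lambda'\\ a_1&a_2&a'\end{bmatrix}^\psi_q=\delta_{\lambda,\lambda'}\delta_{a,a'},$$ and for $a_j,a_j'\in\lambda_j-\mathbb{Z}_{\ge0}$, $$\sum_{\lambda,a}\begin{bmatrix}\lambda_1&\lambda_2&\lambda\\ a_1&a_2&a\end{bmatrix}^\pi_q\begin{bmatrix}\lambda_1&\lambda_2&\lambda\\ a_1'&a_2'&a\end{bmatrix}^\psi_q=\delta_{a_1,a_1'}\delta_{a_2,a_2'}.$$
   Context: Notation: $q=e^{h/2}$ with $h\in\mathbb{C}$, $q^x:=e^{hx/2}$, $[x]_q=\frac{q^x-q^{-x}}{q-q^{-1}}$, $[n]_q!=\prod_{s=1}^n[s]_q$, $[0]_q!=1$, $(-1)^{J/2}:=e^{i\pi J/2}$. The parameter $q$ is generic: $[x]_q\neq0$ for every nonzero $x\in\mathbb{Z}+2\mathbb{Z}\lambda_1+2\mathbb{Z}\lambda_2$. Terms with $[n]_q!$, $n$ a negative integer, in the denominator are omitted; empty products equal $1$. $U_q(\mathfrak{sl}_2)$ is generated by $E,F,K^{\pm1}$ with $KE=q^2EK$, $KF=q^{-2}FK$, $[E,F]=\frac{K-K^{-1}}{q-q^{-1}}$, coproduct $\Delta E=E\otimes K+1\otimes E$, $\Delta F=F\otimes1+K^{-1}\otimes F$, $\Delta K^{\pm1}=K^{\pm1}\otimes K^{\pm1}$. For $\lambda\notin\frac12\mathbb{Z}_{\ge0}$ the Verma module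 $M_\lambda$ has basis $e^\lambda_a$, $a\in\lambda-\mathbb{Z}_{\ge0}$, with $Ke^\lambda_a=q^{2a}e^\lambda_a$, $Ee^\lambda_a=[\lambda-a]_qe^\lambda_{a+1}$, $Fe^\lambda_a=[\lambda+a]_qe^\lambda_{a-1}$. For $\lambda=\lambda_1+\lambda_2-J$, $J\in\mathbb{Z}_{\ge0}$, the module embedding $\psi_\lambda$ is $\psi_\lambda(e^\lambda_a)=\sum_{a_1+a_2=a}\begin{bmatrix}\lambda_1&\lambda_2&\lambda\\ a_1&a_2&a\end{bmatrix}^\psi_qe^{\lambda_1}_{a_1}\otimes e^{\lambda_2}_{a_2}$, where $$\begin{bmatrix}\lambda_1&\lambda_2&\lambda\\ a_1&a_2&a\end{bmatrix}^\psi_q=(-1)^{\frac J2+\lambda_1-a_1}q^{(\lambda_2^2-a_2^2)-(\lambda^2-a^2)-(\lambda_1-a_1)}\frac{[\lambda-a]_q!\,\Delta(\lambda_1,\lambda_2,\lambda)}{\prod_{j=1}^{\lambda-a}[\lambda+a+j]_q}\sum_{z+w=\lambda-a}(-1)^zq^{z(\lambda+a+1)}\frac{\prod_{j=1}^z[\lambda_1+a_1+j]_q\prod_{j=1}^w[\lambda_2+a_2+j]_q}{[z]_q![w]_q![\lambda_1-a_1-z]_q![\lambda_2-a_2-w]_q!}$$ with $z,w\in\mathbb{Z}_{\ge0}$ and $\Delta(\lambda_1,\lambda_2,\lambda)=\Big([J]_q!\prod_{j=0}^{J-1}\frac{[2\lambda_1-j]_q[2\lambda_2-j]_q}{[2\lambda+2+j]_q}\Big)^{1/2}$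 (a fixed choice of square root). The projection symbols are $$\begin{bmatrix}\lambda_1&\lambda_2&\lambda\\ a_1&a_2&a\end{bmatrix}^\pi_q=\frac{\alpha_{\lambda_1,\lambda_1-a_1}\alpha_{\lambda_2,\lambda_2-a_2}}{\alpha_{\lambda,\lambda-a}}\begin{bmatrix}\lambda_1&\lambda_2&\lambda\\ a_1&a_2&a\end{bmatrix}^\psi_q,\qquad\alpha_{\lambda,k}=\frac{(-1)^kq^{k(k-2\lambda+1)}[k]_q!}{\prod_{j=0}^{k-1}[2\lambda-j]_q}.$$ Both kinds of symbols are $0$ unless $a=a_1+a_2$, $a_j\in\lambda_j-\mathbb{Z}_{\ge0}$ and $a\in\lambda-\mathbb{Z}_{\ge0}$. *)

(* Defs.v *)
From HB Require Import structures.
From mathcomp Require Import all_boot all_order all_algebra.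
From mathcomp Require Import ring finmap.
From mathcomp Require Import classical_sets fsbigop reals sequences exp trigo.
From mathcomp.real_closed Require Import complex.
From mathcomp.multinomials Require Import monalg.

Set Implicit Arguments.
Unset Strict Implicit.
Unset Printing Implicit Defensive.
Import Order.TTheory GRing.Theory Num.Theory.
Local Open Scope ring_scope.
Local Open Scope complex_scope.

(* [{malg C[A]}] is the free C-module with basis [<< a >>], a : A. *)
HB.lock Definition linext (C : comNzRingType) (A : choiceType)
    (V : lmodType C) (f : A -> V) (v : {malg C[A]}) : V :=
  \sum_(i <- msupp v) v@_i *: f i.

(* The tensor product of the free modules on A and B is the free module on
   A * B, with [<< a >>] (x) [<< b >>] = [<< (a, b) >>]. *)
HB.lock Definition tens (C : comNzRingType) (A B : choiceType)
    (u : {malg C[A]}) (v : {malg C[B]}) : {malg C[(A * B)%type]} :=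
  linext (fun i => linext (fun j => << (i, j) >>) v) u.

Section FreeModules.
Variable C : comNzRingType.

Section Linext.
Context {A : choiceType} {V : lmodType C}.
Implicit Types (f : A -> V) (v : {malg C[A]}).

Lemma linextEw f v (d : {fset A}) : (msupp v `<=` d)%fset ->
  linext f v = \sum_(i <- d) v@_i *: f i.
Proof.
move=> sub; rewrite linext.unlock (big_fset_incl _ sub) // => i _ /mcoeff_outdom ->.
by rewrite scale0r.
Qed.

Fact linext_is_linear f : linear (linext f).
Proof.
move=> c u v; pose d := (msupp u `|` msupp v `|` msupp (c *: u + v)%R)%fset.
have su : (msupp u `<=` d)%fset by rewrite /d -fsetUA fsubsetUl.
have sv : (msupp v `<=` d)%fset.
  by rewrite /d fsubsetU // fsubsetUr.
have sw : (msupp (c *: u + v)%R `<=` d)%fset by rewrite /d fsubsetUr.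
rewrite (linextEw f su) (linextEw f sv) (linextEw f sw).
rewrite scaler_sumr -big_split /=.
by apply: eq_bigr => i _; rewrite mcoeffD mcoeffZ scalerDl scalerA.
Qed.

HB.instance Definition _ f :=
  GRing.isLinear.Build C {malg C[A]} V *:%R (linext f) (linext_is_linear f).

Lemma linextU f i : linext f << i >> = f i.
Proof.
rewrite (@linextEw f _ [fset i]%fset) ?msuppU_le //.
by rewrite big_seq_fset1 mcoeffUU scale1r.
Qed.

Lemma malg_basis v : v = \sum_(i <- msupp v) v@_i *: << i >>.
Proof.
rewrite {1}[v]monalgE; apply: eq_bigr => i _.
by apply/malgP => j; rewrite mcoeffZ !mcoeffU mulr_natr.
Qed.

Lemma linear_basis_eq (f g : {linear {malg C[A]} -> V}) :
  (forall i, f << i >> = g << i >>) -> f =1 g.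
Proof.
move=> fg v; rewrite [v]malg_basis !linear_sum /=.
by apply: eq_bigr => i _; rewrite !linearZ /= fg.
Qed.

End Linext.

Definition tmap (A B A' B' : choiceType)
    (f : {malg C[A]} -> {malg C[A']}) (g : {malg C[B]} -> {malg C[B']}) :
    {malg C[(A * B)%type]} -> {malg C[(A' * B')%type]} :=
  linext (fun p => tens (f << p.1 >>) (g << p.2 >>)).

HB.instance Definition _ (A B A' B' : choiceType)
    (f : {malg C[A]} -> {malg C[A']}) (g : {malg C[B]} -> {malg C[B']}) :=
  GRing.Linear.on (tmap f g).

Section Tens.
Context {A B : choiceType}.
Implicit Types (u : {malg C[A]}) (v : {malg C[B]}).

Lemma tensU i j : tens << i >> << j >> = << (i, j) >> :> {malg C[(A * B)%type]}.
Proof. by rewrite tens.unlock !linextU. Qed.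

Fact tens_linear_r u : linear (tens u : {malg C[B]} -> _).
Proof.
move=> c v v'; rewrite tens.unlock.
rewrite !(@linextEw _ _ _ u (msupp u)) ?fsubset_refl //.
rewrite scaler_sumr -big_split /=; apply: eq_bigr => i _.
by rewrite linearP scalerDr !scalerA (mulrC c).
Qed.

HB.instance Definition _ u :=
  GRing.isLinear.Build C {malg C[B]} {malg C[(A * B)%type]} *:%R (tens u)
    (tens_linear_r u).

Definition tensl v u := tens u v.

Fact tensl_is_linear v : linear (tensl v).
Proof. by move=> c u u'; rewrite /tensl tens.unlock linearP. Qed.

HB.instance Definition _ v :=
  GRing.isLinear.Build C {malg C[A]} {malg C[(A * B)%type]} *:%R (tensl v)
    (tensl_is_linear v).

End Tens.

Lemma tensDl (A B : choiceType) (u u' : {malg C[A]}) (v : {malg C[B]}) :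
  tens (u + u') v = tens u v + tens u' v.
Proof. exact: (raddfD (tensl v)). Qed.

Lemma tensBl (A B : choiceType) (u u' : {malg C[A]}) (v : {malg C[B]}) :
  tens (u - u') v = tens u v - tens u' v.
Proof. exact: (raddfB (tensl v)). Qed.

Lemma tensZl (A B : choiceType) c (u : {malg C[A]}) (v : {malg C[B]}) :
  tens (c *: u) v = c *: tens u v.
Proof. exact: (linearZ_LR (tensl v)). Qed.

Section Tmap.
Context {A B A' B' : choiceType}.

Lemma tmap_tens (f : {linear {malg C[A]} -> {malg C[A']}})
    (g : {linear {malg C[B]} -> {malg C[B']}}) u v :
  tmap f g (tens u v) = tens (f u) (g v).
Proof.
move: u; apply: (@linear_basis_eq _ _ (tmap f g \o tensl v) (tensl (g v) \o f)).
move=> i; move: v.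
apply: (@linear_basis_eq _ _ (tmap f g \o tens << i >>) (tens (f << i >>) \o g)).
by move=> j /=; rewrite tensU /tmap linextU.
Qed.

Lemma linear_tens_eq (V : lmodType C)
    (f g : {linear {malg C[(A * B)%type]} -> V}) :
  (forall u v, f (tens u v) = g (tens u v)) -> f =1 g.
Proof. by move=> fg; apply: linear_basis_eq => -[i j]; rewrite -tensU. Qed.

End Tmap.
End FreeModules.

Fact addrACA_cancel (V : zmodType) (p t r q p' q' : V) :
  p + t + (r + q) - (p' + r + (t + q')) = (p - p') + (q - q').
Proof.
have -> : p - p' = (p + r) - (p' + r) by rewrite [p' + r]addrC addrKA.
have -> : q - q' = (t + q) - (t + q') by rewrite [t + q]addrC addrKA.
by rewrite [LHS]addrC [p + t + _]addrACA [RHS]addrACA -opprD addrC.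
Qed.

Section QNumbers.
Variable R : realType.
Local Notation C := R[i].

Definition cexp (z : C) : C :=
  (expR (complex.Re z))%:C *
  ((cos (complex.Im z))%:C + 'i * (sin (complex.Im z))%:C).

Lemma cexpD z w : cexp (z + w) = cexp z * cexp w.
Proof.
case: z w => [a b] [c d]; rewrite /cexp /= expRD cosD sinD.
by apply/eqP; rewrite eq_complex /=; apply/andP; split; apply/eqP; ring.
Qed.

Lemma cexp0 : cexp 0 = 1.
Proof.
rewrite /cexp /= expR0 cos0 sin0.
by apply/eqP; rewrite eq_complex /=; apply/andP; split; apply/eqP; ring.
Qed.

Variable h : C.

(* q^x, where q = e^(h/2) *)
Definition qpow (x : C) : C := cexp (h * x / 2).

Lemma qpowD x y : qpow (x + y) = qpow x * qpow y.
Proof. by rewrite /qpow -cexpD mulrDr mulrDl. Qed.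

Lemma qpow0 : qpow 0 = 1.
Proof. by rewrite /qpow mulr0 mul0r cexp0. Qed.

Lemma qpowNK x : qpow (- x) * qpow x = 1.
Proof. by rewrite -qpowD addNr qpow0. Qed.

(* [x]_q; its value is 0 when q = q^-1, which genericity of q excludes *)
Definition qnum (x : C) : C :=
  (qpow x - qpow (- x)) / (qpow 1 - qpow (- 1)).

Definition qfact (n : nat) : C := \prod_(1 <= s < n.+1) qnum s%:R.

Lemma qnum0 : qnum 0 = 0.
Proof. by rewrite /qnum oppr0 subrr mul0r. Qed.

(* U_q(sl_2)-module structures on a vector space V, given by the action of the
   generators E, F, K, K^-1 subject to the defining relations. *)
Record uq_module (V : lmodType C) := UqModule {
  actE : {linear V -> V};
  actF : {linear V -> V};
  actK : {linear V -> V};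
  actKi : {linear V -> V};
  actKK : forall v, actK (actKi v) = v;
  actKiK : forall v, actKi (actK v) = v;
  actKE : forall v, actK (actE v) = qpow 2 *: actE (actK v);
  actKF : forall v, actK (actF v) = qpow (- 2) *: actF (actK v);
  actEF : forall v, actE (actF v) - actF (actE v) =
            (qpow 1 - qpow (- 1))^-1 *: (actK v - actKi v)
}.

Definition uq_hom (V W : lmodType C) (X : uq_module V) (Y : uq_module W)
    (f : {linear V -> W}) : Prop :=
  [/\ forall v, f (actE X v) = actE Y (f v),
      forall v, f (actF X v) = actF Y (f v),
      forall v, f (actK X v) = actK Y (f v) &
      forall v, f (actKi X v) = actKi Y (f v)].

Section Verma.
Variable l : C.

(* The basis vector e^l_a of M_l, with a = l - k, is [<< k >>].
   For k = 0 the value of k.-1 is immaterial: [l - l]_q = 0. *)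
Definition vermaE : {malg C[nat]} -> {malg C[nat]} :=
  linext (fun k => qnum (l - (l - k%:R)) *: << k.-1 >>).
Definition vermaF : {malg C[nat]} -> {malg C[nat]} :=
  linext (fun k => qnum (l + (l - k%:R)) *: << k.+1 >>).
Definition vermaK : {malg C[nat]} -> {malg C[nat]} :=
  linext (fun k => qpow (2 * (l - k%:R)) *: << k >>).
Definition vermaKi : {malg C[nat]} -> {malg C[nat]} :=
  linext (fun k => qpow (- (2 * (l - k%:R))) *: << k >>).

HB.instance Definition _ := GRing.Linear.on vermaE.
HB.instance Definition _ := GRing.Linear.on vermaF.
HB.instance Definition _ := GRing.Linear.on vermaK.
HB.instance Definition _ := GRing.Linear.on vermaKi.

Lemma vermaEU k : vermaE << k >> = qnum (l - (l - k%:R)) *: << k.-1 >>.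
Proof. exact: linextU. Qed.

Lemma vermaFU k : vermaF << k >> = qnum (l + (l - k%:R)) *: << k.+1 >>.
Proof. exact: linextU. Qed.

Lemma vermaKU k : vermaK << k >> = qpow (2 * (l - k%:R)) *: << k >>.
Proof. exact: linextU. Qed.

Lemma vermaKiU k : vermaKi << k >> = qpow (- (2 * (l - k%:R))) *: << k >>.
Proof. exact: linextU. Qed.

Fact vermaKK v : vermaK (vermaKi v) = v.
Proof.
move: v; apply: (@linear_basis_eq _ _ _ (vermaK \o vermaKi) idfun) => k /=.
by rewrite vermaKiU linearZ /= vermaKU scalerA qpowNK scale1r.
Qed.

Fact vermaKiK v : vermaKi (vermaK v) = v.
Proof.
move: v; apply: (@linear_basis_eq _ _ _ (vermaKi \o vermaK) idfun) => k /=.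
by rewrite vermaKU linearZ /= vermaKiU scalerA mulrC qpowNK scale1r.
Qed.

Fact vermaKE v : vermaK (vermaE v) = qpow 2 *: vermaE (vermaK v).
Proof.
move: v; apply: (@linear_basis_eq _ _ _ (vermaK \o vermaE)
  (qpow 2 \*: (vermaE \o vermaK))) => k /=.
rewrite vermaEU vermaKU !linearZ /= vermaKU vermaEU !scalerA.
case: k => [|k] /=.
  by rewrite subr0 subrr qnum0 !(mul0r, mulr0) !scale0r.
rewrite -qpowD mulrC; congr (qpow _ * _ *: _).
by rewrite -addn1 natrD; ring.
Qed.

Fact vermaKF v : vermaK (vermaF v) = qpow (- 2) *: vermaF (vermaK v).
Proof.
move: v; apply: (@linear_basis_eq _ _ _ (vermaK \o vermaF)
  (qpow (- 2) \*: (vermaF \o vermaK))) => k /=.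
rewrite vermaFU vermaKU !linearZ /= vermaKU vermaFU !scalerA.
rewrite -qpowD mulrC; congr (qpow _ * _ *: _).
by rewrite -addn1 natrD; ring.
Qed.

Lemma qnum_comm (a b : C) :
  qnum a * qnum (b + 1) - qnum b * qnum (a + 1) =
  (qpow 1 - qpow (- 1))^-1 * (qpow (a - b) - qpow (- (a - b))).
Proof.
have aux (A A' B B' p p' d : C) : d * (p - p') = 1 \/ d = 0 ->
    (A - A') * d * ((B * p - B' * p') * d) -
    (B - B') * d * ((A * p - A' * p') * d) = d * (A * B' - A' * B).
  case=> [dp|->]; last by rewrite !(mulr0, mul0r) subr0.
  transitivity (d * (p - p') * (d * (A * B' - A' * B))); first by ring.
  by rewrite dp mul1r.
rewrite /qnum !opprD opprK !qpowD aux //.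
have [->|d0] := eqVneq (qpow 1 - qpow (- 1)) 0; first by right; rewrite invr0.
by left; rewrite mulVf.
Qed.

Fact vermaEF v : vermaE (vermaF v) - vermaF (vermaE v) =
  (qpow 1 - qpow (- 1))^-1 *: (vermaK v - vermaKi v).
Proof.
move: v; apply: (@linear_basis_eq _ _ _
  ((vermaE \o vermaF) \- (vermaF \o vermaE))
  ((qpow 1 - qpow (- 1))^-1 \*: (vermaK \- vermaKi))) => k /=.
have -> : vermaE (vermaF << k >>) =
    (qnum (l + (l - k%:R)) * qnum (k%:R + 1)) *: << k >>.
  rewrite vermaFU linearZ /= vermaEU scalerA; congr (_ * qnum _ *: _).
  by rewrite -addn1 natrD; ring.
have -> : vermaF (vermaE << k >>) =
    (qnum k%:R * qnum (l + (l - k%:R) + 1)) *: << k >>.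
  rewrite vermaEU linearZ /= vermaFU scalerA.
  case: k => [|k] /=; first by rewrite subr0 subrr qnum0 !mul0r !scale0r.
  have -> : l - (l - k.+1%:R) = k.+1%:R by ring.
  suff -> : l + (l - k.+1%:R) + 1 = l + (l - k%:R) by [].
  by rewrite -addn1 natrD; ring.
rewrite vermaKU vermaKiU -[LHS]scalerBl -[X in _ = _ *: X]scalerBl [RHS]scalerA.
rewrite qnum_comm.
by have -> : l + (l - k%:R) - k%:R = 2 * (l - k%:R) by ring.
Qed.

Definition verma : uq_module {malg C[nat]} :=
  @UqModule _ vermaE vermaF vermaK vermaKi vermaKK vermaKiK vermaKE vermaKF vermaEF.

End Verma.

(* The coproduct: Delta E = E (x) K + 1 (x) E, Delta F = F (x) 1 + K^-1 (x) F,
   Delta K^{+-1} = K^{+-1} (x) K^{+-1}. *)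
Section TensorModule.
Context {A B : choiceType}.
Variables (X : uq_module {malg C[A]}) (Y : uq_module {malg C[B]}).
Local Notation AB := {malg C[(A * B)%type]}.

Definition tensorE : AB -> AB :=
  tmap (actE X) (actK Y) \+ tmap idfun (actE Y).
Definition tensorF : AB -> AB :=
  tmap (actF X) idfun \+ tmap (actKi X) (actF Y).
Definition tensorK : AB -> AB := tmap (actK X) (actK Y).
Definition tensorKi : AB -> AB := tmap (actKi X) (actKi Y).

HB.instance Definition _ := GRing.Linear.on tensorE.
HB.instance Definition _ := GRing.Linear.on tensorF.
HB.instance Definition _ := GRing.Linear.on tensorK.
HB.instance Definition _ := GRing.Linear.on tensorKi.

Lemma tensorE_tens u v :
  tensorE (tens u v) = tens (actE X u) (actK Y v) + tens u (actE Y v).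
Proof. by rewrite /tensorE /= !tmap_tens. Qed.

Lemma tensorF_tens u v :
  tensorF (tens u v) = tens (actF X u) v + tens (actKi X u) (actF Y v).
Proof. by rewrite /tensorF /= !tmap_tens. Qed.

Lemma tensorK_tens u v : tensorK (tens u v) = tens (actK X u) (actK Y v).
Proof. by rewrite /tensorK tmap_tens. Qed.

Lemma tensorKi_tens u v : tensorKi (tens u v) = tens (actKi X u) (actKi Y v).
Proof. by rewrite /tensorKi tmap_tens. Qed.

Fact tensorKK v : tensorK (tensorKi v) = v.
Proof.
move: v; apply: (@linear_tens_eq _ _ _ _ (tensorK \o tensorKi) idfun) => u v /=.
by rewrite tensorKi_tens tensorK_tens !actKK.
Qed.

Fact tensorKiK v : tensorKi (tensorK v) = v.
Proof.
move: v; apply: (@linear_tens_eq _ _ _ _ (tensorKi \o tensorK) idfun) => u v /=.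
by rewrite tensorK_tens tensorKi_tens !actKiK.
Qed.

Fact tensorKE v : tensorK (tensorE v) = qpow 2 *: tensorE (tensorK v).
Proof.
move: v; apply: (@linear_tens_eq _ _ _ _ (tensorK \o tensorE)
  (qpow 2 \*: (tensorE \o tensorK))) => u v /=.
rewrite tensorE_tens raddfD /= !tensorK_tens tensorE_tens !actKE.
by rewrite tensZl linearZ scalerDr.
Qed.

Fact tensorKF v : tensorK (tensorF v) = qpow (- 2) *: tensorF (tensorK v).
Proof.
move: v; apply: (@linear_tens_eq _ _ _ _ (tensorK \o tensorF)
  (qpow (- 2) \*: (tensorF \o tensorK))) => u v /=.
rewrite tensorF_tens raddfD /= !tensorK_tens tensorF_tens !actKF.
by rewrite actKK actKiK tensZl linearZ scalerDr.
Qed.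

Fact tensorEF v : tensorE (tensorF v) - tensorF (tensorE v) =
  (qpow 1 - qpow (- 1))^-1 *: (tensorK v - tensorKi v).
Proof.
move: v; apply: (@linear_tens_eq _ _ _ _
  ((tensorE \o tensorF) \- (tensorF \o tensorE))
  ((qpow 1 - qpow (- 1))^-1 \*: (tensorK \- tensorKi))) => u v /=.
rewrite tensorE_tens tensorF_tens tensorK_tens tensorKi_tens.
rewrite (raddfD tensorE) (raddfD tensorF) /= !tensorE_tens !tensorF_tens.
have cross : tens (actE X (actKi X u)) (actK Y (actF Y v)) =
             tens (actKi X (actE X u)) (actF Y (actK Y v)).
  have -> : actE X (actKi X u) = qpow 2 *: actKi X (actE X u).
    by rewrite -[LHS](actKiK X) actKE actKK linearZ.
  by rewrite actKF tensZl linearZ scalerA mulrC qpowNK scale1r.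
rewrite cross addrACA_cancel.
rewrite -tensBl -linearB /= !actEF tensZl linearZ /= -scalerDr.
by rewrite tensBl linearB /= addrA subrK.
Qed.

Definition tensor : uq_module AB :=
  @UqModule _ tensorE tensorF tensorK tensorKi
    tensorKK tensorKiK tensorKE tensorKF tensorEF.

End TensorModule.

(* [x]_q <> 0 for every nonzero x in Z + 2 Z l1 + 2 Z l2 *)
Definition q_generic (l1 l2 : C) : Prop :=
  forall m n1 n2 : int,
    let x := m%:~R + 2 * n1%:~R * l1 + 2 * n2%:~R * l2 in
    x != 0 -> qnum x != 0.

(* The square of Delta(l1, l2, l1 + l2 - J). *)
Definition triangle_sq (l1 l2 : C) (J : nat) : C :=
  let l := l1 + l2 - J%:R in
  qfact J * \prod_(0 <= j < J)
    (qnum (2 * l1 - j%:R) * qnum (2 * l2 - j%:R) / qnum (2 * l + 2 + j%:R)).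

Definition alpha (l : C) (k : nat) : C :=
  (- 1) ^+ k * qpow (k%:R * (k%:R - 2 * l + 1)) * qfact k /
  \prod_(0 <= j < k) qnum (2 * l - j%:R).

Section Symbols.
Variables (l1 l2 : C).
(* [Delta J] is the chosen square root of [triangle_sq l1 l2 J]. *)
Variable Delta : nat -> C.

(* The q3j-symbols, with the weights l = l1 + l2 - J, a1 = l1 - k1,
   a2 = l2 - k2, a = l - k encoded by the natural numbers J, k1, k2, k.
   In the sum w = k - z, and the terms with a factorial of a negative integer
   in the denominator are left out. *)
Definition q3j_psi (J k1 k2 k : nat) : C :=
  let l := l1 + l2 - J%:R in
  let a1 := l1 - k1%:R in
  let a2 := l2 - k2%:R in
  let a := l - k%:R in
  if a == a1 + a2 then
    cexp ('i * pi%:C * J%:R / 2) * (- 1) ^+ k1 *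
    qpow ((l2 ^+ 2 - a2 ^+ 2) - (l ^+ 2 - a ^+ 2) - (l1 - a1)) *
    (qfact k * Delta J / \prod_(1 <= j < k.+1) qnum (l + a + j%:R)) *
    \sum_(0 <= z < k.+1 | (z <= k1)%N && (k - z <= k2)%N)
      (- 1) ^+ z * qpow (z%:R * (l + a + 1)) *
      ((\prod_(1 <= j < z.+1) qnum (l1 + a1 + j%:R)) *
       (\prod_(1 <= j < (k - z).+1) qnum (l2 + a2 + j%:R)) /
       (qfact z * qfact (k - z) * qfact (k1 - z) * qfact (k2 - (k - z))))
  else 0.

Definition q3j_pi (J k1 k2 k : nat) : C :=
  alpha l1 k1 * alpha l2 k2 / alpha (l1 + l2 - J%:R) k * q3j_psi J k1 k2 k.

(* On e^l_a with a = l - k, the pairs (a1, a2) with a1 + a2 = a correspond to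
   the pairs (k1, k2) with k1 + k2 = J + k. *)
Definition psi (J : nat) : {malg C[nat]} -> {malg C[(nat * nat)%type]} :=
  linext (fun k => \sum_(0 <= k1 < (J + k).+1)
    q3j_psi J k1 (J + k - k1) k *: << (k1, (J + k - k1)%N) >>).

(* a1 + a2 = l - (k1 + k2 - J) lies in l - Z_{>=0} iff J <= k1 + k2. *)
Definition projection (J : nat) :
    {malg C[(nat * nat)%type]} -> {malg C[nat]} :=
  linext (fun p : nat * nat =>
    if (J <= p.1 + p.2)%N then
      q3j_pi J p.1 p.2 (p.1 + p.2 - J) *: << (p.1 + p.2 - J)%N >>
    else 0).

HB.instance Definition _ J := GRing.Linear.on (psi J).
HB.instance Definition _ J := GRing.Linear.on (projection J).

End Symbols.
End QNumbers.

Definition not_half_nat (R : realType) (l : R[i]) : Prop :=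
  forall n : nat, l != n%:R / 2.

(* Main.v *)
(* All psi-symbols come from the highest weight vectors of the tensor product:
   Delta(F)^k expands by a q-binomial formula into the sum over z + w, so by the
   q-Pascal rule the symbols satisfy the recursion of the F-action; the k = 0
   symbols are killed by E.  Passing to the pi-symbols multiplies by ratios of
   the contravariant forms alpha, which exchanges the E- and F-recursions; hence
   the projections are homomorphisms as well.  The composite pi_l psi_l' is then
   a homomorphism of Verma modules that is determined by a highest weight
   vector: it vanishes for l <> l', and for l = l' it is a scalar that the
   q-Vandermonde identity evaluates to 1.  The completeness relation follows
   because weight spaces are finite-dimensional, so that a right inverse matrix
   is a left inverse. *)

Require Import Defs.
From HB Require Import structures.
From mathcomp Require Import all_boot all_order all_algebra.
From mathcomp Require Import ring zify finmap.
From mathcomp Require Import classical_sets fsbigop reals exp trigo.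
From mathcomp.real_closed Require Import complex.
From mathcomp.multinomials Require Import monalg.

Set Implicit Arguments.
Unset Strict Implicit.
Unset Printing Implicit Defensive.
Import Order.TTheory GRing.Theory Num.Theory.
Local Open Scope classical_set_scope.
Local Open Scope ring_scope.
Local Open Scope complex_scope.

(** * q-binomial identities *)

Section QCalculus.
Variables (R : realType) (h : R[i]).
Local Notation C := R[i].
Local Notation qpow := (qpow h).
Local Notation qnum := (qnum h).
Local Notation qfact := (qfact h).

(** The phase (-1)^{J/2} is needed only squared: a product of a projection symbol and an embedding
    symbol with the same J contains it twice. *)
Lemma cexp_half_pi_sqr (n : nat) :
  cexp ('i * (pi : R)%:C * n%:R / 2) ^+ 2 = (- 1) ^+ n.
Proof.
rewrite expr2 -cexpD -mulrDl -mulr2n -[_ *+ 2]mulr_natr mulfK ?pnatr_eq0 //.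
elim: n => [|n IHn]; first by rewrite mulr0 cexp0.
rewrite -addn1 natrD mulrDr cexpD IHn exprD expr1; congr (_ * _).
have -> : 'i * (pi : R)%:C * 1%:R = Complex 0 (pi : R).
  by apply/eqP; rewrite eq_complex /=; apply/andP; split; apply/eqP; ring.
rewrite /cexp /= cospi sinpi expR0.
by apply/eqP; rewrite eq_complex /=; apply/andP; split; apply/eqP; ring.
Qed.

Lemma qpow_neq0 x : qpow x != 0.
Proof.
apply/eqP => x0; have /eqP := qpowNK h x.
by rewrite x0 mulr0 eq_sym oner_eq0.
Qed.

Lemma qnumD x y : qnum (x + y) = qpow (- y) * qnum x + qpow x * qnum y.
Proof. by rewrite /qnum opprD !qpowD; ring. Qed.

Lemma qfact0 : qfact 0 = 1.
Proof. by rewrite /qfact big_geq. Qed.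

Lemma qfactS n : qfact n.+1 = qfact n * qnum n.+1%:R.
Proof. by rewrite /qfact big_nat_recr. Qed.

Definition qbin (n z : nat) : C := qfact n / (qfact z * qfact (n - z)).

Definition qrising (x : C) (n : nat) : C := \prod_(0 <= j < n) qnum (x + j%:R).

Lemma qrising0 x : qrising x 0 = 1.
Proof. by rewrite /qrising big_geq. Qed.

Lemma qrisingS x n : qrising x n.+1 = qrising x n * qnum (x + n%:R).
Proof. by rewrite /qrising big_nat_recr. Qed.

Hypothesis qnumS_neq0 : forall n : nat, qnum n.+1%:R != 0.

Lemma qfact_neq0 n : qfact n != 0.
Proof.
elim: n => [|n IHn]; first by rewrite qfact0 oner_neq0.
by rewrite qfactS mulf_neq0.
Qed.

(* The q-Pascal rule, summed against an arbitrary function. *)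
Lemma qbin_sumS n (f : nat -> C) :
  \sum_(0 <= z < n.+2) qbin n.+1 z * f z =
  \sum_(0 <= z < n.+1) qbin n z *
    (qpow (- (n - z)%:R) * f z.+1 + qpow z%:R * f z).
Proof.
(* Split [n+1] = [z + (n+1-z)] by the addition formula: one part cancels a factor of [z]!, the other
   a factor of [n+1-z]!. *)
have split_bin z : (z <= n.+1)%N -> qbin n.+1 z * f z =
    qfact n / (qfact z * qfact (n.+1 - z)) *
      (qpow (- (n.+1 - z)%:R) * qnum z%:R) * f z +
    qfact n / (qfact z * qfact (n.+1 - z)) *
      (qpow z%:R * qnum (n.+1 - z)%:R) * f z.
  move=> zn; rewrite /qbin qfactS.
  have -> : n.+1%:R = z%:R + (n.+1 - z)%:R :> C by rewrite -natrD subnKC.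
  by rewrite qnumD; ring.
rewrite (eq_big_nat _ _ (F2 := fun z =>
    qfact n / (qfact z * qfact (n.+1 - z)) *
      (qpow (- (n.+1 - z)%:R) * qnum z%:R) * f z +
    qfact n / (qfact z * qfact (n.+1 - z)) *
      (qpow z%:R * qnum (n.+1 - z)%:R) * f z)); last first.
  by move=> z /andP[_ zn]; apply: split_bin.
(* The first sum loses its term z = 0 and the second its term z = n+1, both because [0] = 0; then
   both have n+1 terms. *)
rewrite big_split /= big_nat_recl // qnum0 !(mulr0, mul0r) add0r.
rewrite [X in _ + X]big_nat_recr //= subnn qnum0 !(mulr0, mul0r) addr0.
rewrite -big_split /=; apply: eq_big_nat => z /andP[_ zn].
rewrite subSS [(n.+1 - z)%N]subSn // !qfactS /qbin.
have := qnumS_neq0 z; have := qnumS_neq0 (n - z).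
have := qfact_neq0 z; have := qfact_neq0 (n - z).
by move=> *; field; do ?[apply/andP; split].
Qed.

(** Induction on n: the q-Pascal rule replaces each summand by two neighbours, which recombine to
    the new factor [x+y+n], split as [(y+z) + (x+n-z)]. *)
Lemma q_Vandermonde n x y :
  \sum_(0 <= z < n.+1) qbin n z * (qpow ((n - z)%:R * y - z%:R * x) *
     qrising x (n - z) * qrising y z) = qrising (x + y) n.
Proof.
elim: n => [|n IHn].
  rewrite big_nat1 /qbin !qrising0 qfact0 !mul0r subr0 qpow0.
  by rewrite !mulr1 divr1.
rewrite qbin_sumS qrisingS -IHn mulr_suml; apply: eq_big_nat => z /andP[_ zn].
rewrite ltnS in zn.
rewrite subSS subSn // !qrisingS.
have -> : x + y + n%:R = (y + z%:R) + (x + (n - z)%:R).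
  by have -> : n%:R = z%:R + (n - z)%:R :> C; [rewrite -natrD subnKC | ring].
rewrite (qnumD (y + z%:R)).
have -> : (n - z)%:R * y - z.+1%:R * x = ((n - z)%:R * y - z%:R * x) - x :> C.
  by rewrite -addn1 natrD; ring.
have -> : (n - z).+1%:R * y - z%:R * x = ((n - z)%:R * y - z%:R * x) + y :> C.
  by rewrite -addn1 natrD; ring.
rewrite opprD !qpowD; ring.
Qed.

(** The last n-m factors, read backwards, ascend from x-n+1. *)
Lemma qfalling_split x n m : (m <= n)%N ->
  \prod_(0 <= j < n) qnum (x - j%:R) =
  (\prod_(0 <= j < m) qnum (x - j%:R)) * qrising (x - n%:R + 1) (n - m).
Proof.
move=> mn; rewrite -{1}(subnKC mn) /qrising; move: (n - m)%N (subnKC mn) => d.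
move=> <-; rewrite (big_cat_nat (n := m)) ?leq_addr //=; congr (_ * _).
rewrite -{1}[m]add0n big_addn addKn [RHS]big_nat_rev /= add0n.
apply: eq_big_nat => j /andP[_ jd]; congr qnum.
by rewrite !natrD natrB // -addn1 natrD; ring.
Qed.

End QCalculus.

(** * Nonvanishing of the q-numbers in the denominators *)

Section Genericity.
Variables (R : realType) (h l1 l2 : R[i]).
Hypothesis q_gen : q_generic h l1 l2.

Lemma qnumS_neq0 n : qnum h n.+1%:R != 0.
Proof.
have := @q_gen n.+1%:Z 0 0; rewrite /= !mulr0 !mul0r !addr0.
by apply; rewrite pnatr_eq0.
Qed.

(** The argument could vanish only if n1 l1 + n2 l2 = j/2. The pairs (1,0), (0,1) and (1,1) give the
    three families below. *)
Lemma qnum_sub_neq0 (n1 n2 : nat) (j : nat) :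
  not_half_nat (n1%:R * l1 + n2%:R * l2) ->
  qnum h (2 * (n1%:R * l1 + n2%:R * l2) - j%:R) != 0.
Proof.
move=> lgen; have := @q_gen (- j%:Z) n1%:Z n2%:Z.
have -> : (- j%:Z)%:~R + 2 * n1%:~R * l1 + 2 * n2%:~R * l2 =
  2 * (n1%:R * l1 + n2%:R * l2) - j%:R by rewrite mulrNz -!pmulrn; ring.
apply; rewrite subr_eq0; apply/eqP => e; have /eqP := lgen j; apply.
by rewrite -e [2 * _]mulrC mulfK ?pnatr_eq0.
Qed.

Hypothesis l1_gen : not_half_nat l1.
Hypothesis l2_gen : not_half_nat l2.
Hypothesis l12_gen : not_half_nat (l1 + l2).

Lemma qnum_2l1_neq0 (j : nat) : qnum h (2 * l1 - j%:R) != 0.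
Proof.
by have := @qnum_sub_neq0 1 0 j; rewrite mul1r mul0r addr0; apply.
Qed.

Lemma qnum_2l2_neq0 (j : nat) : qnum h (2 * l2 - j%:R) != 0.
Proof.
by have := @qnum_sub_neq0 0 1 j; rewrite mul1r mul0r add0r; apply.
Qed.

Lemma qnum_2l_neq0 (J j : nat) : qnum h (2 * (l1 + l2 - J%:R) - j%:R) != 0.
Proof.
have := @qnum_sub_neq0 1 1 (J + J + j); rewrite !mul1r => /(_ l12_gen).
by congr (qnum _ _ != 0); rewrite !natrD; ring.
Qed.

Lemma qrising_2l_neq0 (J : nat) :
  qrising h (2 * (l1 + l2 - J%:R) + 2) J != 0.
Proof.
rewrite /qrising big_nat; elim/big_ind : _ => [|x y|j /= jJ].
  exact: oner_neq0.
  exact: mulf_neq0.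
(* Here 2l + 2 + j = 2(l1 + l2) - (2J - 2 - j), and j < J keeps the natural subtraction exact. *)
have := qnum_2l_neq0 0 (2 * J - 2 - j); congr (qnum _ _ != 0).
have -> : (2 * J - 2 - j)%N%:R = 2 * J%:R - 2 - j%:R :> R[i].
  by rewrite !natrB ?natrM //; lia.
by rewrite subr0; ring.
Qed.

End Genericity.

(** * Recursions for the q3j-symbols *)

Section Symbols.
Variables (R : realType) (h l1 l2 : R[i]) (Delta : nat -> R[i]).
Local Notation C := R[i].
Local Notation qpow := (qpow h).
Local Notation qnum := (qnum h).
Local Notation qfact := (qfact h).
Local Notation qbin := (qbin h).
Local Notation c := (q3j_psi h l1 l2 Delta).
Local Notation lam J := (l1 + l2 - J%:R).

(** The share of one tensor factor in the z-th term of a symbol, without 1/[z]!. The value 0 for z >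
    k encodes the omission of terms with factorials of negative integers. *)
Definition psi_factor (l : C) (k z : nat) : C :=
  if (z <= k)%N then
    (\prod_(1 <= j < z.+1) qnum (l + (l - k%:R) + j%:R)) / qfact (k - z)
  else 0.

Lemma psi_factorSS l k z :
  psi_factor l k.+1 z.+1 = qnum (2 * l - k%:R) * psi_factor l k z.
Proof.
rewrite /psi_factor ltnS subSS; case: ifP => _; last by rewrite mulr0.
rewrite big_nat_recl // mulrA; congr (_ * _ / _).
  by congr qnum; rewrite -addn1 natrD; ring.
by apply: eq_bigr => j _; congr qnum; rewrite -!(addn1 k) -addn1 !natrD; ring.
Qed.

(** The z-th summand with the binomial coefficient [qbin] and the scalar [psi_scal] split off, so
    that the step from k to k+1 becomes an instance of the q-Pascal rule. *)
Definition psi_term (J k1 k2 k z : nat) : C :=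
  let l := lam J in let a := l - k%:R in let a2 := l2 - k2%:R in
  (- 1) ^+ (k1 + z) *
  qpow ((l2 ^+ 2 - a2 ^+ 2) - (l ^+ 2 - a ^+ 2) - k1%:R + z%:R * (l + a + 1)) *
  psi_factor l1 k1 z * psi_factor l2 k2 (k - z).

Definition psi_scal (J k : nat) : C :=
  cexp ('i * (pi : R)%:C * J%:R / 2) * Delta J /
  \prod_(1 <= j < k.+1) qnum (lam J + (lam J - k%:R) + j%:R).

Lemma weight_eq (J k1 k2 k : nat) :
  (lam J - k%:R == l1 - k1%:R + (l2 - k2%:R)) = (k1 + k2 == J + k)%N.
Proof.
rewrite -(eqr_nat C) !natrD -subr_eq0 -[in RHS]subr_eq0; congr (_ == 0); ring.
Qed.

Lemma q3j_psi_out J k1 k2 k : (k1 + k2 != J + k)%N -> c J k1 k2 k = 0.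
Proof. by rewrite /q3j_psi weight_eq => /negPf ->. Qed.

Lemma q3j_psiE J k1 k2 k : (k1 + k2 = J + k)%N ->
  c J k1 k2 k =
  psi_scal J k * \sum_(0 <= z < k.+1) qbin k z * psi_term J k1 k2 k z.
Proof.
move=> e; rewrite /q3j_psi weight_eq e eqxx /psi_scal.
rewrite [X in _ * X = _]big_mkcond !mulr_sumr.
apply: eq_big_nat => z _; rewrite /psi_term /psi_factor /qbin.
case: ifP => [/andP[-> ->]|]; last first.
  by case: (z <= k1)%N => /= [->|_]; rewrite ?(mulr0, mul0r).
rewrite [l1 - (l1 - _)]subKr !qpowD exprD !invfM; ring.
Qed.

(** The two halves of the q-Pascal rule match the two summands of the coproduct of F: this half is F
    (x) 1, and [psi_term_shiftr] is K^-1 (x) F. *)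
Lemma psi_term_shiftl J k1 k2 k z : (z <= k)%N ->
  qpow (- (k - z)%:R) * psi_term J k1 k2 k.+1 z.+1 =
  if k1 is i.+1 then qnum (2 * l1 - i%:R) * psi_term J i k2 k z else 0.
Proof.
case: k1 => [|i] zk; rewrite /psi_term.
  by rewrite /psi_factor !(mul0r, mulr0).
rewrite psi_factorSS subSS addSn addnS -[(i + z).+2]add2n exprD sqrrN expr1n.
set X := (X in _ * (_ * qpow X * _ * _) = _).
set Y := (X in _ = _ * (_ * qpow X * _ * _)).
have -> : qpow Y = qpow (- (k - z)%:R) * qpow X; last by ring.
rewrite -qpowD; congr qpow.
by rewrite /X /Y natrB // -(addn1 z) -(addn1 i) -(addn1 k) !natrD; ring.
Qed.

Lemma psi_term_shiftr J k1 k2 k z : (z <= k)%N -> (k1 + k2 = J + k.+1)%N ->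
  qpow z%:R * psi_term J k1 k2 k.+1 z =
  qpow (- (2 * (l1 - k1%:R))) *
  if k2 is i.+1 then qnum (2 * l2 - i%:R) * psi_term J k1 i k z else 0.
Proof.
case: k2 => [|i] zk e; rewrite /psi_term subSn //.
  by rewrite {2}/psi_factor !(mul0r, mulr0).
rewrite psi_factorSS.
set X := (X in _ * (_ * qpow X * _ * _) = _).
set Y := (X in _ = _ * (_ * (_ * qpow X * _ * _))).
suff E : qpow z%:R * qpow X = qpow (- (2 * (l1 - k1%:R))) * qpow Y.
  by ring: E.
rewrite -!qpowD; congr qpow.
(* The exponents agree only on matching weights, so J is eliminated by the weight condition. *)
have J_eq : J%:R = k1%:R + i%:R - k%:R :> C.
  by apply/eqP; rewrite eq_sym subr_eq -!natrD eqr_nat; lia.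
by rewrite /X /Y J_eq -(addn1 i) -(addn1 k) !natrD; ring.
Qed.

Hypothesis q_gen : q_generic h l1 l2.
Hypothesis l12_gen : not_half_nat (l1 + l2).

(** This is the coefficient form of compatibility with F. Raising k adds the factor [2l - k] to the
    denominator of [psi_scal], and the q-Pascal rule splits the remaining sum. *)
Lemma q3j_psi_rec J k1 k2 k : (k1 + k2 = J + k.+1)%N ->
  qnum (2 * lam J - k%:R) * c J k1 k2 k.+1 =
  (if k1 is i.+1 then qnum (2 * l1 - i%:R) * c J i k2 k else 0) +
  qpow (- (2 * (l1 - k1%:R))) *
  (if k2 is i.+1 then qnum (2 * l2 - i%:R) * c J k1 i k else 0).
Proof.
move=> e; rewrite q3j_psiE //.
have -> : psi_scal J k.+1 = psi_scal J k / qnum (2 * lam J - k%:R).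
  rewrite /psi_scal big_nat_recl // invfM mulrA [LHS]mulrAC.
  congr (_ / _ / qnum _); last by rewrite -addn1 natrD; ring.
  apply: eq_bigr => j _; congr qnum.
  by rewrite -(addn1 k) -(addn1 j) !natrD; ring.
rewrite mulrA mulrCA mulfV ?mulr1; last exact: qnum_2l_neq0.
rewrite (qbin_sumS (qnumS_neq0 q_gen)).
rewrite (eq_big_nat _ _ (F2 := fun z => qbin k z *
    (if k1 is i.+1 then qnum (2 * l1 - i%:R) * psi_term J i k2 k z else 0) +
    qbin k z * (qpow (- (2 * (l1 - k1%:R))) *
    if k2 is i.+1 then qnum (2 * l2 - i%:R) * psi_term J k1 i k z else 0)));
  last first.
  move=> z /andP[_ zk]; rewrite ltnS in zk.
  by rewrite psi_term_shiftl // (psi_term_shiftr zk e) mulrDr.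
rewrite big_split /= mulrDr; congr (_ + _).
  case: k1 e => [|i] e; first by rewrite big1 ?mulr0 // => z _; rewrite mulr0.
  rewrite q3j_psiE; last by lia.
  by rewrite !mulr_sumr; apply: eq_bigr => z _; ring.
case: k2 e => [|i] e; first by rewrite big1 ?mulr0 // => z _; rewrite !mulr0.
rewrite q3j_psiE; last by lia.
by rewrite !mulr_sumr; apply: eq_bigr => z _; ring.
Qed.

(** For k = 0 only z = 0 occurs, so the highest weight vector has coefficients in closed form. *)
Lemma q3j_psi_top k1 k2 :
  c (k1 + k2) k1 k2 0 =
  cexp ('i * (pi : R)%:C * (k1 + k2)%:R / 2) * Delta (k1 + k2) *
  ((- 1) ^+ k1 * qpow (l2 ^+ 2 - (l2 - k2%:R) ^+ 2 - k1%:R)) /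
  (qfact k1 * qfact k2).
Proof.
rewrite q3j_psiE ?addn0 // big_nat1 /psi_scal /psi_term /psi_factor /qbin.
rewrite !big_geq // !subn0 qfact0 !leq0n addn0 !subr0 mul0r addr0 mulr1 subrr.
by rewrite subr0 !divr1 invfM; ring.
Qed.

(** The coproduct of E kills the highest weight vector: two neighbouring coefficients contribute to
    each basis vector, with opposite signs. *)
Lemma q3j_psi_singular k1 k2 :
  qnum k1.+1%:R * qpow (2 * (l2 - k2%:R)) * c (k1 + k2).+1 k1.+1 k2 0 +
  qnum k2.+1%:R * c (k1 + k2).+1 k1 k2.+1 0 = 0.
Proof.
have := q3j_psi_top k1.+1 k2; have := q3j_psi_top k1 k2.+1.
rewrite addnS addSn => -> ->; rewrite !qfactS.
have n1 := qnumS_neq0 q_gen k1; have n2 := qnumS_neq0 q_gen k2.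
have f1 := qfact_neq0 (qnumS_neq0 q_gen) k1.
have f2 := qfact_neq0 (qnumS_neq0 q_gen) k2.
have -> : qpow (l2 ^+ 2 - (l2 - k2.+1%:R) ^+ 2 - k1%:R) =
  qpow (2 * (l2 - k2%:R)) * qpow (l2 ^+ 2 - (l2 - k2%:R) ^+ 2 - k1.+1%:R).
  by rewrite -qpowD; congr qpow; rewrite -(addn1 k1) -(addn1 k2) !natrD; ring.
rewrite exprS; field.
by rewrite n1 n2 f1 f2.
Qed.

(** Multiplied by the denominator of Delta^2, the sum becomes the q-Vandermonde sum term by term. *)
Lemma q3j_psi_norm J : (forall j, qnum (2 * l1 - j%:R) != 0) ->
    (forall j, qnum (2 * l2 - j%:R) != 0) ->
    Delta J ^+ 2 = triangle_sq h l1 l2 J ->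
  \sum_(0 <= i < J.+1)
     q3j_pi h l1 l2 Delta J i (J - i) 0 * c J i (J - i) 0 = 1.
Proof.
(* With this choice x + y = 2l + 2, so the right-hand side of q-Vandermonde is the denominator of
   Delta^2. *)
move=> n1 n2 DeltaE; set x := 2 * l1 - J%:R + 1; set y := 2 * l2 - J%:R + 1.
pose P1 := \prod_(0 <= j < J) qnum (2 * l1 - j%:R).
pose P2 := \prod_(0 <= j < J) qnum (2 * l2 - j%:R).
have Vdm := q_Vandermonde (qnumS_neq0 q_gen) J x y.
have xy0 : qrising h (x + y) J != 0.
  have := qrising_2l_neq0 q_gen l12_gen J.
  by congr (qrising _ _ _ != 0); rewrite /x /y; ring.
have Dl : Delta J ^+ 2 = qfact J * P1 * P2 / qrising h (x + y) J.
  rewrite DeltaE /triangle_sq -!mulrA; congr (_ * _).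
  rewrite /P1 /P2 /qrising -prodfV -!big_split /=.
  apply: eq_bigr => j _; rewrite mulrA; congr (_ / qnum _).
  by rewrite /x /y; ring.
apply: (mulIf xy0); rewrite mul1r -[in RHS]Vdm mulr_suml.
apply: eq_big_nat => i /andP[_ iJ]; rewrite ltnS in iJ.
have := q3j_psi_top i (J - i); rewrite subnKC // /q3j_pi => ->.
have f n := qfact_neq0 (qnumS_neq0 q_gen) n.
have phase2 := cexp_half_pi_sqr R J.
set phase := cexp _ in phase2 *.
(* The signs of the two alphas, of the squared phase and of the two symbols cancel. *)
have sgn :
    (- 1) ^+ i * (- 1) ^+ (J - i) * phase ^+ 2 * ((- 1) ^+ i) ^+ 2 = 1 :> C.
  rewrite phase2 -exprD subnKC // -expr2 -!exprM !(mulnC _ 2) !exprM.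
  by rewrite sqrrN !expr1n mulr1.
set X := l2 ^+ 2 - _ - _.
have expo : qpow (i%:R * (i%:R - 2 * l1 + 1)) *
      qpow ((J - i)%:R * ((J - i)%:R - 2 * l2 + 1)) * qpow X ^+ 2 =
    qpow ((J - i)%:R * y - i%:R * x).
  by rewrite expr2 -!qpowD; congr qpow; rewrite /X /x /y natrB //; ring.
rewrite -expo /qbin.
have p1 : \prod_(0 <= j < i) qnum (2 * l1 - j%:R) != 0.
  by rewrite prodf_seq_neq0; apply/allP => j _; exact: n1.
have p2 : \prod_(0 <= j < J - i) qnum (2 * l2 - j%:R) != 0.
  by rewrite prodf_seq_neq0; apply/allP => j _; exact: n2.
(* The denominators of the alphas are the first i and J-i factors of [P1] and [P2]; what is left are
   the rising products of q-Vandermonde. *)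
move: Dl; rewrite /P1 /P2 (qfalling_split _ _ iJ) (qfalling_split _ _ (leq_subr i J)).
rewrite subKn // -/x -/y => Dl.
have -> : alpha h (lam J) 0 = 1.
  by rewrite /alpha qfact0 big_geq // mul0r qpow0 !mulr1 divr1.
rewrite /alpha.
move: Dl sgn; set d := Delta J; set s := (- 1) ^+ i; set t := (- 1) ^+ (J - i).
move=> Dl sgn.
have -> : forall a b p q u v fi fj r : C,
    s * a * fi / p * (t * b * fj / q) / 1 * (phase * d * (s * u) / v) *
    (phase * d * (s * u) / v) * r =
    (s * t * phase ^+ 2 * s ^+ 2) * (d ^+ 2 * r) * (a * b * u ^+ 2) * fi * fj /
    (p * q * v ^+ 2).
  by move=> *; rewrite !invfM invr1; ring.
rewrite sgn Dl mul1r.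
have fJ := f J; have fi := f i; have fJi := f (J - i)%N.
by field; do ?[apply/andP; split].
Qed.

End Symbols.

(** * Coordinates and linear maps on sums of basis vectors *)

Lemma mcoeff_diag (C : comNzRingType) (n m : nat) (f : nat -> C) (i j : nat) :
  (i < n)%N -> (i + j = m)%N ->
  (\sum_(0 <= k < n) f k *: << (k, (m - k)%N) >> : {malg C[(nat * nat)%type]})
    @_(i, j) = f i.
Proof.
move=> i_n <-; rewrite raddf_sum /= (bigD1_seq i) ?mem_index_iota ?iota_uniq //=.
rewrite mcoeffZ mcoeffU addKn eqxx mulr1 big1 ?addr0 // => k ki.
by rewrite mcoeffZ mcoeffU xpair_eqE (negPf ki) mulr0.
Qed.

Lemma tensZr (C : comNzRingType) (A B : choiceType) c
    (u : {malg C[A]}) (v : {malg C[B]}) : tens u (c *: v) = c *: tens u v.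
Proof. exact: (linearZ_LR (tens u)). Qed.

Lemma tensZZ (C : comNzRingType) (A B : choiceType) (a b : C) (i : A) (j : B) :
  tens (a *: << i >>) (b *: << j >>) = (a * b) *: << (i, j) >>.
Proof. by rewrite tensZl tensZr tensU scalerA. Qed.

Lemma linearZ1 (C : nzRingType) (V W : lmodType C) (f : {linear V -> W})
    (s a : C) v x : f v = a *: x -> f (s *: v) = (s * a) *: x.
Proof. by move=> fv; rewrite linearZ /= fv scalerA. Qed.

Lemma linearZ2 (C : nzRingType) (V W : lmodType C) (f : {linear V -> W})
    (s a b : C) v x y : f v = a *: x + b *: y ->
  f (s *: v) = (s * a) *: x + (s * b) *: y.
Proof. by move=> fv; rewrite linearZ /= fv scalerDr !scalerA. Qed.

Lemma linear_sum_scale (C : nzRingType) (V : lmodType C) (f : {linear V -> V})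
    (s : C) (n : nat) (g : nat -> V) :
  (forall i, (i < n)%N -> f (g i) = s *: g i) ->
  f (\sum_(0 <= i < n) g i) = s *: \sum_(0 <= i < n) g i.
Proof.
move=> fg; rewrite linear_sum scaler_sumr.
by apply: eq_big_nat => i /andP[_]; apply: fg.
Qed.

(** The pattern of the E-action on a weight vector: neighbouring terms land on one basis vector. The
    two vanishing conditions remove the end terms, where the predecessor of 0 would be 0. *)
Lemma sum_shift_down (C : nzRingType) (V : lmodType C) (n : nat)
    (a b : nat -> C) (x : nat -> nat -> V) : a 0%N = 0 -> b n = 0 ->
  \sum_(0 <= i < n.+1) (a i *: x i.-1 (n - i)%N + b i *: x i (n - i).-1) =
  \sum_(0 <= i < n) (a i.+1 + b i) *: x i (n.-1 - i)%N.
Proof.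
move=> a0 bn; rewrite big_split /= big_nat_recl // a0 scale0r add0r.
rewrite [X in _ + X]big_nat_recr //= bn scale0r addr0 -big_split /=.
apply: eq_big_nat => i _; rewrite scalerDl.
by have [-> ->] : (n - i.+1 = n.-1 - i)%N /\ ((n - i).-1 = n.-1 - i)%N by lia.
Qed.

(** The same pattern for the F-action, where the weight space grows by one dimension; the zero
    branches stand for the missing neighbours at both ends. *)
Lemma sum_shift_up (C : nzRingType) (V : lmodType C) (n : nat)
    (a b : nat -> C) (x : nat -> nat -> V) :
  \sum_(0 <= i < n.+1) (a i *: x i.+1 (n - i)%N + b i *: x i (n - i).+1) =
  \sum_(0 <= i < n.+2) ((if i is i'.+1 then a i' else 0) +
     (if (n.+1 - i)%N is j.+1 then b i else 0)) *: x i (n.+1 - i)%N.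
Proof.
under [RHS]eq_bigr => i _ do rewrite scalerDl.
rewrite !big_split /=; congr (_ + _).
  by rewrite [RHS]big_nat_recl // scale0r add0r.
rewrite [RHS]big_nat_recr //= subnn scale0r addr0.
by apply: eq_big_nat => i /andP[_ iJ]; rewrite subSn.
Qed.

(** * Module homomorphisms out of a Verma module *)

Lemma uq_homE_step (R : realType) (h : R[i]) (V W : lmodType R[i])
    (X : uq_module h V) (Y : uq_module h W) (f : {linear V -> W})
    (s : R[i]) (v w : V) : s != 0 -> actF X v = s *: w ->
  (forall u, f (actF X u) = actF Y (f u)) ->
  (forall u, f (actK X u) = actK Y (f u)) ->
  (forall u, f (actKi X u) = actKi Y (f u)) ->
  f (actE X v) = actE Y (f v) ->
  f (actE X w) = actE Y (f w).
Proof.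
move=> s0 Fv fF fK fKi fE; apply: (scalerI s0).
rewrite -[LHS]linearZ -[in LHS]linearZ -[RHS]linearZ -[in RHS]linearZ /= -Fv fF.
rewrite -[actE X _](subrK (actF X (actE X v))) actEF.
rewrite -[RHS](subrK (actF Y (actE Y (f v)))) actEF.
by rewrite linearD linearZ linearB /= fF fK fKi fE.
Qed.

Lemma uq_homKi (R : realType) (h : R[i]) (V W : lmodType R[i])
    (X : uq_module h V) (Y : uq_module h W) (f : {linear V -> W}) :
  (forall u, f (actK X u) = actK Y (f u)) ->
  forall u, f (actKi X u) = actKi Y (f u).
Proof. by move=> fK u; rewrite -[LHS](actKiK Y) -fK actKK. Qed.

(* On a Verma module commutation with E follows from commutation with F and K
   by induction on the weight, as E F = F E + (K - K^-1) / (q - q^-1) there and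
   F reaches every basis vector from the highest one. *)
Lemma uq_hom_verma (R : realType) (h l : R[i]) (V : lmodType R[i])
    (Y : uq_module h V) (f : {linear {malg R[i][nat]} -> V}) :
  (forall k : nat, qnum h (2 * l - k%:R) != 0) ->
  (forall k, f (vermaF h l << k >>) = actF Y (f << k >>)) ->
  (forall k, f (vermaK h l << k >>) = actK Y (f << k >>)) ->
  actE Y (f << 0%N >>) = 0 ->
  uq_hom (verma h l) Y f.
Proof.
move=> nz fF fK fE.
have homF v : f (vermaF h l v) = actF Y (f v).
  by move: v; apply: (@linear_basis_eq _ _ _ (f \o vermaF h l) (actF Y \o f)).
have homK v : f (vermaK h l v) = actK Y (f v).
  by move: v; apply: (@linear_basis_eq _ _ _ (f \o vermaK h l) (actK Y \o f)).
have homKi := uq_homKi (X := verma h l) homK.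
split=> //= v; move: v.
apply: (@linear_basis_eq _ _ _ (f \o vermaE h l) (actE Y \o f)).
elim=> [|k IHk] /=.
  by rewrite vermaEU subr0 subrr qnum0 scale0r linear0 fE.
apply: (uq_homE_step (X := verma h l) (nz k) _ homF homK homKi IHk).
by rewrite /= vermaFU; congr (qnum _ _ *: _); ring.
Qed.

(** * The embeddings *)

Section Psi.
Variables (R : realType) (h l1 l2 : R[i]) (Delta : nat -> R[i]).
Local Notation C := R[i].
Local Notation qpow := (qpow h).
Local Notation qnum := (qnum h).
Local Notation c := (q3j_psi h l1 l2 Delta).
Local Notation lam J := (l1 + l2 - J%:R).
Local Notation psi := (psi h l1 l2 Delta).
Local Notation tensorE := (tensorE (verma h l1) (verma h l2)).
Local Notation tensorF := (tensorF (verma h l1) (verma h l2)).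
Local Notation tensorK := (tensorK (verma h l1) (verma h l2)).

Lemma psiU J k : psi J << k >> =
  \sum_(0 <= i < (J + k).+1) c J i (J + k - i) k *: << (i, (J + k - i)%N) >>.
Proof. exact: linextU. Qed.

Lemma psiZ J s v : psi J (s *: v) = s *: psi J v.
Proof. exact: linearZ_LR. Qed.

Lemma tensorEU i j : tensorE << (i, j) >> =
  (qnum i%:R * qpow (2 * (l2 - j%:R))) *: << (i.-1, j) >> +
  qnum j%:R *: << (i, j.-1) >>.
Proof.
rewrite -tensU tensorE_tens /= !vermaEU vermaKU !subKr tensZZ; congr (_ + _).
by rewrite tensZr tensU.
Qed.

Lemma tensorEZU s i j : tensorE (s *: << (i, j) >>) =
  (s * (qnum i%:R * qpow (2 * (l2 - j%:R)))) *: << (i.-1, j) >> +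
  (s * qnum j%:R) *: << (i, j.-1) >>.
Proof. exact: (linearZ2 s (tensorEU i j)). Qed.

Lemma tensorFU i j : tensorF << (i, j) >> =
  qnum (2 * l1 - i%:R) *: << (i.+1, j) >> +
  (qpow (- (2 * (l1 - i%:R))) * qnum (2 * l2 - j%:R)) *: << (i, j.+1) >>.
Proof.
have two l k : l + (l - k%:R) = 2 * l - k%:R :> C by ring.
rewrite -tensU tensorF_tens /= !vermaFU vermaKiU !two.
congr (_ + _); first by rewrite tensZl tensU.
by rewrite tensZZ.
Qed.

Lemma tensorFZU s i j : tensorF (s *: << (i, j) >>) =
  (s * qnum (2 * l1 - i%:R)) *: << (i.+1, j) >> +
  (s * (qpow (- (2 * (l1 - i%:R))) * qnum (2 * l2 - j%:R))) *: << (i, j.+1) >>.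
Proof. exact: (linearZ2 s (tensorFU i j)). Qed.

Lemma tensorKU i j : tensorK << (i, j) >> =
  qpow (2 * (l1 - i%:R) + 2 * (l2 - j%:R)) *: << (i, j) >>.
Proof.
by rewrite -tensU tensorK_tens /= !vermaKU tensZZ -qpowD tensU.
Qed.

Lemma tensorKZU s i j : tensorK (s *: << (i, j) >>) =
  (s * qpow (2 * (l1 - i%:R) + 2 * (l2 - j%:R))) *: << (i, j) >>.
Proof. exact: (linearZ1 s (tensorKU i j)). Qed.

Lemma tensorE_psi J k : tensorE (psi J << k >>) =
  \sum_(0 <= i < J + k)
    (c J i.+1 (J + k - i.+1) k *
       (qnum i.+1%:R * qpow (2 * (l2 - (J + k - i.+1)%:R))) +
     c J i (J + k - i) k * qnum (J + k - i)%:R)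
    *: << (i, ((J + k).-1 - i)%N) >>.
Proof.
rewrite psiU linear_sum /=.
under eq_bigr => i _ do rewrite tensorEZU.
apply: (@sum_shift_down _ _ _
  (fun i => c J i (J + k - i) k *
          (qnum i%:R * qpow (2 * (l2 - (J + k - i)%:R))))
  (fun i => c J i (J + k - i) k * qnum (J + k - i)%:R)
  (fun i j => << (i, j) >>)).
  by rewrite qnum0 mul0r mulr0.
by rewrite subnn qnum0 mulr0.
Qed.

Lemma tensorK_psi J k :
  tensorK (psi J << k >>) = qpow (2 * (lam J - k%:R)) *: psi J << k >>.
Proof.
rewrite psiU; apply: linear_sum_scale => i iJ.
rewrite /= tensorKZU; apply/esym; apply: etrans (scalerA _ _ _) _.
congr (_ *: _).
rewrite mulrC; congr (_ * qpow _).
by rewrite natrB // natrD; ring.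
Qed.

Hypothesis q_gen : q_generic h l1 l2.
Hypothesis l12_gen : not_half_nat (l1 + l2).

(** By [uq_hom_verma] three facts suffice: the recursion [q3j_psi_rec] for F, equality of weights
    for K, and [q3j_psi_singular] for E on the highest weight vector. *)
Lemma psi_hom J :
  uq_hom (verma h (lam J)) (tensor (verma h l1) (verma h l2)) (psi J).
Proof.
apply: uq_hom_verma => [k|k|k|].
- exact: (qnum_2l_neq0 q_gen).
- have two : lam J + (lam J - k%:R) = 2 * lam J - k%:R :> C by ring.
  rewrite vermaFU two /= psiZ !psiU addnS [RHS]linear_sum /=.
  under [RHS]eq_bigr => i _ do rewrite tensorFZU.
  apply/esym; apply: etrans (@sum_shift_up _ _ _
    (fun i => c J i (J + k - i) k * qnum (2 * l1 - i%:R))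
    (fun i => c J i (J + k - i) k *
       (qpow (- (2 * (l1 - i%:R))) * qnum (2 * l2 - (J + k - i)%:R)))
    (fun i j => << (i, j) >>)) _.
  apply/esym; rewrite [LHS]scaler_sumr; apply: eq_big_nat => i /andP[_ iJ].
  apply: etrans (scalerA _ _ _) _; congr (_ *: _).
  rewrite q3j_psi_rec //; last by lia.
  congr (_ + _); first by case: i iJ => [|i] iJ //; rewrite mulrC subSS.
  rewrite ltnS in iJ; case e : ((J + k).+1 - i)%N => [|j].
    by rewrite mulr0.
  by have -> : (J + k - i)%N = j; [lia | ring].
- by rewrite vermaKU /= psiZ tensorK_psi.
- rewrite /= tensorE_psi big_nat big1 // => i /andP[_ iJ].
  rewrite addn0 in iJ *.
  have := q3j_psi_singular Delta q_gen i (J - i.+1).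
  have -> : (i + (J - i.+1)).+1 = J by lia.
  have -> : (J - i.+1).+1 = (J - i)%N by lia.
  by rewrite mulrC [qnum (J - i)%:R * _]mulrC => ->; rewrite scale0r.
Qed.

(** Read off from [psi_hom] by comparing the coefficients of one basis vector in the E-relation,
    instead of manipulating the z-sum. *)
Lemma q3j_psi_recE J i j k : (i + j).+1 = (J + k)%N ->
  c J i.+1 j k * (qnum i.+1%:R * qpow (2 * (l2 - j%:R))) +
  c J i j.+1 k * qnum j.+1%:R =
  if k is k'.+1 then qnum k%:R * c J i j k' else 0.
Proof.
move=> e; case: (psi_hom J) => homE _ _ _; move: (homE << k >>).
rewrite /= tensorE_psi vermaEU subKr psiZ /=.
move/(congr1 (fun v : {malg C[(nat * nat)%type]} => v@_(i, j))) => /esym.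
rewrite mcoeff_diag; [|lia|lia].
have -> : (J + k - i.+1)%N = j by lia.
have -> : (J + k - i)%N = j.+1 by lia.
move=> ->; rewrite mcoeffZ; case: k e => [|k] e; first by rewrite qnum0 mul0r.
rewrite /= psiU mcoeff_diag; [|lia|lia].
by have -> : (J + k - i)%N = j by lia.
Qed.

End Psi.

(** * The projections *)

Section Projection.
Variables (R : realType) (h l1 l2 : R[i]) (Delta : nat -> R[i]).
Local Notation C := R[i].
Local Notation qpow := (qpow h).
Local Notation qnum := (qnum h).
Local Notation alpha := (alpha h).
Local Notation c := (q3j_psi h l1 l2 Delta).
Local Notation p := (q3j_pi h l1 l2 Delta).
Local Notation lam J := (l1 + l2 - J%:R).

(** Up to sign and a power of q, the ratio is [k+1], the coefficient of E, over [2l - k], the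
    coefficient of F. This is how multiplication by alphas exchanges the two recursions. *)
Lemma alphaS l k : alpha l k.+1 =
  - (qpow (2 * (k.+1%:R - l)) * qnum k.+1%:R / qnum (2 * l - k%:R) * alpha l k).
Proof.
rewrite /alpha qfactS big_nat_recr //= invfM exprS.
have -> : qpow (k.+1%:R * (k.+1%:R - 2 * l + 1)) =
    qpow (2 * (k.+1%:R - l)) * qpow (k%:R * (k%:R - 2 * l + 1)).
  by rewrite -qpowD; congr qpow; rewrite -(addn1 k) natrD; ring.
by ring.
Qed.

Lemma alphaS_inv l k : (alpha l k.+1)^-1 =
  - (qpow (2 * (l - k.+1%:R)) * qnum (2 * l - k%:R) / qnum k.+1%:R *
     (alpha l k)^-1).
Proof.
have X : (qpow (2 * (k.+1%:R - l)))^-1 = qpow (2 * (l - k.+1%:R)).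
  apply: (mulfI (qpow_neq0 h (2 * (k.+1%:R - l)))).
  by rewrite mulfV ?qpow_neq0 // -qpowD -[LHS](qpow0 h); congr qpow; ring.
rewrite alphaS -X; move: (qpow _) (qnum _) (qnum _) (alpha _ _) => x y z t.
by rewrite invrN !invfM invrK; ring.
Qed.

Lemma q3j_pi_out J k1 k2 k : (k1 + k2 != J + k)%N -> p J k1 k2 k = 0.
Proof. by move=> /q3j_psi_out e; rewrite /q3j_pi e mulr0. Qed.

Hypothesis q_gen : q_generic h l1 l2.
Hypothesis l1_gen : not_half_nat l1.
Hypothesis l2_gen : not_half_nat l2.
Hypothesis l12_gen : not_half_nat (l1 + l2).

(** The F-recursion [q3j_psi_rec] multiplied by alphas: each [2l - k] turns into the matching
    [k+1]. *)
Lemma q3j_pi_recE J i j k : (i + j = J + k.+1)%N ->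
  (if i is i'.+1 then
     qnum i%:R * qpow (2 * (l2 - j%:R)) * p J i' j k else 0) +
  (if j is j'.+1 then qnum j%:R * p J i j' k else 0) =
  qnum k.+1%:R * p J i j k.+1.
Proof.
move=> e.
have n0 := qnum_2l_neq0 q_gen l12_gen J k.
have k0 := qnumS_neq0 q_gen k.
have -> : qnum k.+1%:R * p J i j k.+1 =
    - qpow (2 * (lam J - k.+1%:R)) *
    (alpha l1 i * alpha l2 j / alpha (lam J) k) *
    (qnum (2 * lam J - k%:R) * c J i j k.+1).
  rewrite /q3j_pi alphaS_inv.
  move: (alpha _ k)^-1 (alpha _ _) (alpha _ _) => a b d.
  by field; rewrite k0.
rewrite q3j_psi_rec // [RHS]mulrDr; congr (_ + _).
  case: i e => [|i] e; first by rewrite mulr0.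
  have i0 := qnum_2l1_neq0 q_gen l1_gen i.
  rewrite /q3j_pi alphaS; move: (alpha _ k)^-1 (alpha _ _) (alpha _ _) => a b d.
  have -> : qpow (2 * (l2 - j%:R)) =
      qpow (2 * (lam J - k.+1%:R)) * qpow (2 * (i.+1%:R - l1)).
    rewrite -qpowD; congr qpow.
    have -> : J%:R = i.+1%:R + j%:R - k.+1%:R :> C.
      by apply/eqP; rewrite eq_sym subr_eq -!natrD eqr_nat; lia.
    ring.
  by field; rewrite i0.
case: j e => [|j] e; first by rewrite !mulr0.
have j0 := qnum_2l2_neq0 q_gen l2_gen j.
rewrite /q3j_pi [alpha l2 j.+1]alphaS.
move: (alpha _ k)^-1 (alpha _ _) (alpha _ _) => a b d.
(* The powers of q from the two alpha ratios cancel the K^-1 factor of the coproduct of F, by the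
   weight condition. *)
have E : qpow (2 * (lam J - k.+1%:R)) * qpow (2 * (j.+1%:R - l2)) *
    qpow (- (2 * (l1 - i%:R))) = 1.
  rewrite -!qpowD -[RHS](qpow0 h); congr qpow.
  have -> : J%:R = i%:R + j.+1%:R - k.+1%:R :> C.
    by apply/eqP; rewrite eq_sym subr_eq -!natrD eqr_nat; lia.
  ring.
rewrite -[LHS]mul1r -[X in X * _ = _]E.
by field; rewrite j0.
Qed.

(** The dual exchange: the E-recursion [q3j_psi_recE] multiplied by alphas. *)
Lemma q3j_pi_recF J i j k : (i + j).+1 = (J + k)%N ->
  qnum (2 * l1 - i%:R) * p J i.+1 j k +
  qpow (- (2 * (l1 - i%:R))) * qnum (2 * l2 - j%:R) * p J i j.+1 k =
  if k is k'.+1 then qnum (2 * lam J - k'%:R) * p J i j k' else 0.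
Proof.
move=> e; have i0 := qnum_2l1_neq0 q_gen l1_gen i.
have j0 := qnum_2l2_neq0 q_gen l2_gen j.
have Eq : qpow (- (2 * (l1 - i%:R))) * qpow (2 * (j.+1%:R - l2)) =
  qpow (2 * (i.+1%:R - l1) + 2 * (j%:R - l2)).
  by rewrite -!qpowD; congr qpow; rewrite -(addn1 i) -(addn1 j) !natrD; ring.
have Ei : qpow (2 * (i.+1%:R - l1)) =
  qpow (2 * (i.+1%:R - l1) + 2 * (j%:R - l2)) * qpow (2 * (l2 - j%:R)).
  by rewrite -!qpowD; congr qpow; ring.
have -> : qnum (2 * l1 - i%:R) * p J i.+1 j k +
  qpow (- (2 * (l1 - i%:R))) * qnum (2 * l2 - j%:R) * p J i j.+1 k =
  - qpow (2 * (i.+1%:R - l1) + 2 * (j%:R - l2)) *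
    (alpha l1 i * alpha l2 j / alpha (lam J) k) *
  (c J i.+1 j k * (qnum i.+1%:R * qpow (2 * (l2 - j%:R))) +
   c J i j.+1 k * qnum j.+1%:R).
  rewrite /q3j_pi !alphaS.
  move: (alpha _ k)^-1 (alpha _ _) (alpha _ _) => a b d.
  by rewrite Ei -Eq; field; rewrite i0 j0.
rewrite (q3j_psi_recE Delta q_gen l12_gen e).
case: k e => [|k] e; first by rewrite mulr0.
have n0 := qnum_2l_neq0 q_gen l12_gen J k.
have k0 := qnumS_neq0 q_gen k.
rewrite /q3j_pi alphaS_inv.
have E : qpow (2 * (i.+1%:R - l1) + 2 * (j%:R - l2)) *
    qpow (2 * (lam J - k.+1%:R)) = 1.
  rewrite -qpowD -[RHS](qpow0 h); congr qpow.
  have -> : J%:R = i.+1%:R + j%:R - k.+1%:R :> C.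
    by apply/eqP; rewrite eq_sym subr_eq -!natrD eqr_nat; lia.
  ring.
move: (alpha _ k)^-1 (alpha _ _) (alpha _ _) E => a b d E.
rewrite -[RHS]mul1r -[X in _ = X * _]E.
by field; rewrite k0.
Qed.

End Projection.

Lemma linear_pair (C : nzRingType) (V W : lmodType C) (f : {linear V -> W})
    (a b a' b' : C) x y x' y' : f x = a' *: x' -> f y = b' *: y' ->
  f (a *: x + b *: y) = (a * a') *: x' + (b * b') *: y'.
Proof. by move=> fx fy; rewrite linearD !linearZ /= fx fy !scalerA. Qed.

Lemma scalerDl_eq (C : nzRingType) (V : lmodType C) (a b a' b' : C)
    (x y z : V) :
  a *: x = a' *: z -> b *: y = b' *: z -> a *: x + b *: y = (a' + b') *: z.
Proof. by move=> -> ->; rewrite scalerDl. Qed.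

Section ProjectionHom.
Variables (R : realType) (h l1 l2 : R[i]) (Delta : nat -> R[i]).
Local Notation C := R[i].
Local Notation qpow := (qpow h).
Local Notation qnum := (qnum h).
Local Notation p := (q3j_pi h l1 l2 Delta).
Local Notation lam J := (l1 + l2 - J%:R).
Local Notation projection := (projection h l1 l2 Delta).
Local Notation tensorE := (tensorE (verma h l1) (verma h l2)).
Local Notation tensorF := (tensorF (verma h l1) (verma h l2)).
Local Notation tensorK := (tensorK (verma h l1) (verma h l2)).

(** For i + j < J the truncated index is 0 and the symbol itself vanishes, so the case distinction
    in [projection] disappears. *)
Lemma projectionU J i j : projection J << (i, j) >> =
  p J i j (i + j - J)%N *: << (i + j - J)%N >>.
Proof.
rewrite /Defs.projection linextU /=; case: leqP => // ltJ.
by rewrite q3j_pi_out ?scale0r //; lia.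
Qed.

Lemma projectionZ J s v : projection J (s *: v) = s *: projection J v.
Proof. exact: linearZ_LR. Qed.

Hypothesis q_gen : q_generic h l1 l2.
Hypothesis l1_gen : not_half_nat l1.
Hypothesis l2_gen : not_half_nat l2.
Hypothesis l12_gen : not_half_nat (l1 + l2).

Lemma projection_tensorE J i j :
  projection J (tensorE << (i, j) >>) =
  vermaE h (lam J) (projection J << (i, j) >>).
Proof.
rewrite tensorEU; set a := _ * qpow _; set b := qnum j%:R.
rewrite (linear_pair a b (projectionU J i.-1 j) (projectionU J i j.-1)).
rewrite /a /b {a b}.
rewrite projectionU.
rewrite (linearZ1 (p J i j (i + j - J)%N) (vermaEU h (lam J) (i + j - J)%N)) /=.
rewrite subKr.
have [ltJ|leJ] := ltnP J (i + j); last first.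
  (* The right-hand side contains [0]. On the left, lowering i or j gives a total below J, where the
     symbols vanish, and an index that is already 0 carries the coefficient [0]. *)
  have -> : (i + j - J = 0)%N by lia.
  rewrite qnum0 mulr0 scale0r.
  have -> : qnum i%:R * qpow (2 * (l2 - j%:R)) * p J i.-1 j (i.-1 + j - J) = 0.
    case: i leJ => [|i] leJ; first by rewrite qnum0 !mul0r.
    by rewrite q3j_pi_out ?mulr0 //; lia.
  have -> : qnum j%:R * p J i j.-1 (i + j.-1 - J) = 0.
    case: j leJ => [|j] leJ; first by rewrite qnum0 !mul0r.
    by rewrite q3j_pi_out ?mulr0 //; lia.
  by rewrite !scale0r addr0.
have [k ek] : exists k, (i + j = J + k.+1)%N by exists (i + j - J).-1; lia.
have rec := q3j_pi_recE Delta q_gen l1_gen l2_gen l12_gen ek.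
rewrite ek addKn /= [p J i j _ * _]mulrC -rec {rec}.
apply: scalerDl_eq.
  case: i ltJ ek => [|i] ltJ ek; first by rewrite qnum0 !mul0r !scale0r.
  by have -> : (i.+1.-1 + j - J = k)%N by lia.
case: j ltJ ek => [|j] ltJ ek; first by rewrite qnum0 !mul0r !scale0r.
by have -> : (i + j.+1.-1 - J = k)%N by lia.
Qed.

Lemma projection_tensorF J i j :
  projection J (tensorF << (i, j) >>) =
  vermaF h (lam J) (projection J << (i, j) >>).
Proof.
rewrite tensorFU; set a := qnum _; set b := qpow _ * _.
rewrite (linear_pair a b (projectionU J i.+1 j) (projectionU J i j.+1)).
rewrite /a /b {a b}.
rewrite projectionU.
rewrite (linearZ1 (p J i j (i + j - J)%N) (vermaFU h (lam J) (i + j - J)%N)) /=.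
rewrite addSn addnS; apply: etrans (scalerDl_eq (erefl _) (erefl _)) _.
have [ltJ|leJ] := ltnP (i + j).+1 J.
  by rewrite !q3j_pi_out ?mulr0 ?mul0r ?addr0 ?scale0r //; lia.
have ek : ((i + j).+1 = J + ((i + j).+1 - J))%N by lia.
rewrite (q3j_pi_recF Delta q_gen l1_gen l2_gen l12_gen ek).
(* Index 0 means i + j + 1 = J: F lands in the highest weight, the recursion gives 0, and the symbol
   at (i, j) vanishes. *)
case e : ((i + j).+1 - J)%N => [|k].
  by rewrite q3j_pi_out ?mul0r ?scale0r //; lia.
have -> : (i + j - J = k)%N by lia.
by congr (_ *: _); rewrite mulrC; congr (_ * qnum _); ring.
Qed.

Lemma projection_tensorK J i j :
  projection J (tensorK << (i, j) >>) =
  vermaK h (lam J) (projection J << (i, j) >>).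
Proof.
rewrite tensorKU projectionZ projectionU.
rewrite (linearZ1 (p J i j (i + j - J)%N) (vermaKU h (lam J) (i + j - J)%N)) /=.
apply: etrans (scalerA _ _ _) _.
have [ltJ|leJ] := ltnP (i + j) J.
  by rewrite q3j_pi_out ?mul0r ?mulr0 ?scale0r //; lia.
rewrite mulrC; congr (_ * qpow _ *: _).
by rewrite natrB // natrD; ring.
Qed.

(** The source is a tensor product, so [uq_hom_verma] does not apply, and the E-relation comes from
    its own recursion. *)
Lemma projection_hom J :
  uq_hom (tensor (verma h l1) (verma h l2)) (verma h (lam J)) (projection J).
Proof.
have homE v : projection J (tensorE v) = vermaE h (lam J) (projection J v).
  move: v; apply: (@linear_basis_eq _ _ _ (projection J \o tensorE)
    (vermaE h (lam J) \o projection J)) => -[i j]; exact: projection_tensorE.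
have homF v : projection J (tensorF v) = vermaF h (lam J) (projection J v).
  move: v; apply: (@linear_basis_eq _ _ _ (projection J \o tensorF)
    (vermaF h (lam J) \o projection J)) => -[i j]; exact: projection_tensorF.
have homK v : projection J (tensorK v) = vermaK h (lam J) (projection J v).
  move: v; apply: (@linear_basis_eq _ _ _ (projection J \o tensorK)
    (vermaK h (lam J) \o projection J)) => -[i j]; exact: projection_tensorK.
split; [exact: homE | exact: homF | exact: homK |].
exact: (uq_homKi (X := tensor _ _) (Y := verma h (lam J)) homK).
Qed.

End ProjectionHom.

(** * Reduction of sums over infinite index sets to finite ones, and linear extension *)

Lemma fsum_diag (V : nmodType) (N : nat) (f : nat * nat -> V) :
  (forall q, (q.1 + q.2 != N)%N -> f q = 0) ->
  \sum_(q \in [set: nat * nat]) f q = \sum_(0 <= i < N.+1) f (i, N - i)%N.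
Proof.
move=> f0.
rewrite (fsbigE [seq (i, N - i)%N | i <- index_iota 0 N.+1]) //.
- by rewrite big_map; apply: eq_bigl => i; rewrite in_setT.
- by rewrite map_inj_uniq ?iota_uniq // => i j [].
move=> [i j] _ ij; apply: f0 => /=; apply: contra ij => /eqP ijN.
apply/mapP; exists i; first by rewrite mem_index_iota; lia.
by rewrite -ijN addKn.
Qed.

Lemma fsum_lt (V : nmodType) (M : nat) (f : nat -> V) :
  (forall i, (M <= i)%N -> f i = 0) ->
  \sum_(i \in [set: nat]) f i = \sum_(0 <= i < M) f i.
Proof.
move=> f0; rewrite (fsbigE (index_iota 0 M)) ?iota_uniq //.
  by apply: eq_bigl => i; rewrite in_setT.
by move=> i _; rewrite mem_index_iota /= -leqNgt; apply: f0.
Qed.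

Lemma linear_sumZ (C : comNzRingType) (V W : lmodType C) (f : {linear V -> W})
    (n : nat) (a b : nat -> C) (x : nat -> V) (y : W) :
  (forall i, (i < n)%N -> f (x i) = b i *: y) ->
  f (\sum_(0 <= i < n) a i *: x i) = (\sum_(0 <= i < n) b i * a i) *: y.
Proof.
move=> fx; rewrite linear_sum scaler_suml; apply: eq_big_nat => i /andP[_ i_n].
by rewrite linearZ /= fx // scalerA mulrC.
Qed.

Lemma exchange_scale (C : nzRingType) (V : lmodType C) (n : nat)
    (a : nat -> C) (b : nat -> nat -> C) (x : nat -> V) (z : nat) :
  (z < n)%N ->
  (forall i, (i < n)%N -> \sum_(0 <= J < n) a J * b J i = (i == z)%:R) ->
  \sum_(0 <= J < n) a J *: (\sum_(0 <= i < n) b J i *: x i) = x z.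
Proof.
move=> zn ab; under eq_bigr => J _ do rewrite scaler_sumr.
rewrite exchange_big /=.
rewrite (eq_big_nat _ _ (F2 := fun i => (i == z)%:R *: x i)); last first.
  move=> i /andP[_ i_n]; rewrite -ab // scaler_suml.
  by apply: eq_bigr => J _; rewrite scalerA.
rewrite (bigD1_seq z) ?mem_index_iota ?iota_uniq //= eqxx scale1r.
by rewrite big1 ?addr0 // => i /negPf ->; rewrite scale0r.
Qed.

Lemma linear_supp_eq0 (C : comNzRingType) (A : choiceType) (V : lmodType C)
    (f : {linear {malg C[A]} -> V}) (v : {malg C[A]}) :
  (forall q, q \in msupp v -> f << q >> = 0) -> f v = 0.
Proof.
move=> f0; rewrite (malg_basis v) linear_sum big_seq big1 // => q /f0 fq.
by rewrite linearZ /= fq scaler0.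
Qed.

Lemma sum_linear_supp_id (C : comNzRingType) (A : choiceType)
    (f : nat -> {linear {malg C[A]} -> {malg C[A]}}) (M : nat)
    (v : {malg C[A]}) :
  (forall q, q \in msupp v -> \sum_(0 <= J < M) f J << q >> = << q >>) ->
  \sum_(0 <= J < M) f J v = v.
Proof.
move=> fid; rewrite [RHS]malg_basis.
have fE J : f J v = \sum_(q <- msupp v) v@_q *: f J << q >>.
  rewrite {1}(malg_basis v) linear_sum.
  by apply: eq_bigr => q _; rewrite linearZ.
under eq_bigr => J _ do rewrite fE.
rewrite exchange_big /=; apply: eq_big_seq => q qv.
by rewrite -scaler_sumr fid.
Qed.

Lemma mcoeffZU (C : comNzRingType) (A : choiceType) (a : C) (k l : A) :
  (a *: << k >>)@_l = a * (k == l)%:R.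
Proof. by rewrite mcoeffZ mcoeffU. Qed.

Lemma mcoeff_scaleU (C : comNzRingType) (A : choiceType) (a b : C) (k l : A) :
  a *: << k >> = b *: << l >> :> {malg C[A]} -> a = b * (l == k)%:R.
Proof. by move/(congr1 (mcoeff k)); rewrite !mcoeffZU eqxx mulr1. Qed.

Lemma mcoeffZUU (C : comNzRingType) (A : choiceType) (a : C) (k : A) :
  (a *: << k >>)@_k = a.
Proof. by rewrite mcoeffZU eqxx mulr1. Qed.

(** * Orthogonality and completeness *)

Section Orthogonality.
Variables (R : realType) (h l1 l2 : R[i]) (Delta : nat -> R[i]).
Local Notation C := R[i].
Local Notation c := (q3j_psi h l1 l2 Delta).
Local Notation p := (q3j_pi h l1 l2 Delta).
Local Notation lam J := (l1 + l2 - J%:R).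
Local Notation psi := (psi h l1 l2 Delta).
Local Notation projection := (projection h l1 l2 Delta).
Hypothesis q_gen : q_generic h l1 l2.
Hypothesis l1_gen : not_half_nat l1.
Hypothesis l2_gen : not_half_nat l2.
Hypothesis l12_gen : not_half_nat (l1 + l2).
Hypothesis DeltaE : forall J : nat, Delta J ^+ 2 = triangle_sq h l1 l2 J.

Lemma projection_psiU J J' k : projection J (psi J' << k >>) =
  (\sum_(0 <= i < (J' + k).+1)
     p J i (J' + k - i) (J' + k - J)%N * c J' i (J' + k - i) k) *:
  << (J' + k - J)%N >>.
Proof.
rewrite psiU; apply: (@linear_sumZ C _ _ (projection J) _
  (fun i => c J' i (J' + k - i) k)
  (fun i => p J i (J' + k - i) (J' + k - J)%N)
  (fun i => << (i, (J' + k - i)%N) >>)) => i iJ /=.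
by rewrite projectionU subnKC.
Qed.

Let homP := projection_hom Delta q_gen l1_gen l2_gen l12_gen.
Let homS := psi_hom Delta q_gen l12_gen.

Lemma projection_psi_top J J' :
  projection J (psi J' << 0%N >>) = (J == J')%:R *: << 0%N >>.
Proof.
have [<-|JJ'] := eqVneq J J'.
  rewrite projection_psiU addn0 subnn; congr (_ *: _).
  exact: (q3j_psi_norm q_gen l12_gen
    (qnum_2l1_neq0 q_gen l1_gen) (qnum_2l2_neq0 q_gen l2_gen)).
rewrite scale0r projection_psiU addn0.
(* For J' < J the weight of the vector exceeds the highest weight of the target, so all symbols
   vanish. *)
have [J'J|J'J] := ltnP J' J.
  rewrite big_nat big1 ?scale0r // => i /andP[_ iJ].
  by rewrite q3j_pi_out ?mul0r //; lia.
(* For J < J' the image is a multiple s of a basis vector below the top. E kills it and yet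
   multiplies that vector by [n+1], which is nonzero, so s = 0. *)
case: (homS J') (homP J) => /= SE _ _ _ [/= PE _ _ _].
have := PE (psi J' << 0%N >>); rewrite -SE vermaEU subr0 subrr qnum0 scale0r.
rewrite (raddf0 (psi J')) (raddf0 (projection J)) projection_psiU addn0.
move: (\sum_(_ <= _ < _) _) => s.
have [n en] : exists n, (J' - J = n.+1)%N by exists (J' - J).-1; lia.
rewrite en (linearZ1 s (vermaEU _ (lam J) n.+1)) subKr /=.
move/(congr1 (fun v : {malg C[nat]} => v@_n)); rewrite mcoeff0 mcoeffZUU.
move/esym/eqP; rewrite mulf_eq0 (negPf (qnumS_neq0 q_gen n)) orbF => /eqP ->.
by rewrite scale0r.
Qed.

(** F transports the identity from the highest weight vector down the module; the coefficient
    [2l' - k] is nonzero and can be cancelled. *)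
Lemma projection_psi_basis J J' k :
  projection J (psi J' << k >>) = (J == J')%:R *: << k >>.
Proof.
elim: k => [|k IHk]; first exact: projection_psi_top.
case: (homS J') (homP J) => /= _ SF _ _ [/= _ PF _ _].
have := PF (psi J' << k >>); rewrite -SF IHk vermaFU psiZ projectionZ.
rewrite (linearZ1 _ (vermaFU _ (lam J) k)).
have two : lam J' + (lam J' - k%:R) = 2 * lam J' - k%:R :> C by ring.
move=> e; apply: (scalerI (qnum_2l_neq0 q_gen l12_gen J' k)).
rewrite -two; apply: etrans e _.
apply/esym; apply: etrans (scalerA _ _ _) _; congr (_ *: _).
by have [<-|_] := eqVneq J J'; rewrite ?mulr1 ?mul1r ?mulr0 ?mul0r.
Qed.

Lemma projection_psi J v : projection J (psi J v) = v.
Proof.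
move: v; apply: (@linear_basis_eq C _ _ (projection J \o psi J) idfun) => k /=.
by apply: etrans (projection_psi_basis J J k) _; rewrite eqxx; exact: scale1r.
Qed.

Lemma orthogonality J J' N : (J <= N)%N -> (J' <= N)%N ->
  \sum_(0 <= i < N.+1) p J i (N - i) (N - J) * c J' i (N - i) (N - J') =
  (J == J')%:R.
Proof.
move=> JN J'N; have := projection_psi_basis J J' (N - J')%N.
rewrite projection_psiU subnKC //.
move/mcoeff_scaleU => ->.
by have [<-|_] := eqVneq J J'; rewrite ?eqxx ?mul1r ?mul0r.
Qed.

(** In weight l1 + l2 - N both the basis vectors and the admissible J are numbered by 0, ..., N. The
    matrices are therefore square, and orthogonality makes them mutually inverse. *)
Lemma completeness N i j : (i <= N)%N -> (j <= N)%N ->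
  \sum_(0 <= J < N.+1) p J i (N - i) (N - J) * c J j (N - j) (N - J) =
  (j == i)%:R.
Proof.
move=> iN jN.
pose A : 'M[C]_N.+1 := \matrix_(J, i) p J i (N - i) (N - J).
pose B : 'M[C]_N.+1 := \matrix_(i, J) c J i (N - i) (N - J).
have /mulmx1C/matrixP/(_ (inord j) (inord i)) : A *m B = 1%:M.
  apply/matrixP => J J'; rewrite !mxE -(orthogonality (leq_ord J) (leq_ord J')).
  by rewrite big_mkord; apply: eq_bigr => k _; rewrite !mxE.
rewrite !mxE -val_eqE /= !inordK ?ltnS // => <-; rewrite big_mkord.
by apply: eq_bigr => J _; rewrite !mxE !inordK ?ltnS // mulrC.
Qed.

Lemma psi_projection_basis N i j : (i + j = N)%N ->
  \sum_(0 <= J < N.+1) psi J (projection J << (i, j) >>) = << (i, j) >>.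
Proof.
move=> ijN; have iN : (i < N.+1)%N by lia.
have -> : j = (N - i)%N by lia.
rewrite (eq_big_nat _ _ (F2 := fun J => p J i (N - i) (N - J) *:
  \sum_(0 <= k < N.+1) c J k (N - k) (N - J) *: << (k, (N - k)%N) >>)).
  apply: (@exchange_scale C _ N.+1 (fun J => p J i (N - i) (N - J))
    (fun J k => c J k (N - k) (N - J)) (fun k => << (k, (N - k)%N) >>) i)
    => // k kN.
  exact: completeness.
move=> J /andP[_ JN]; rewrite projectionU subnKC // psiZ psiU subnKC //.
Qed.

Lemma psi_projection (v : {malg C[(nat * nat)%type]}) :
  \sum_(J \in [set: nat]) psi J (projection J v) = v.
Proof.
(* Every projection with J >= M kills v, which makes the sum over J finite. *)
pose M := (\max_(q <- msupp v) (q.1 + q.2).+1)%N.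
have ltM q : q \in msupp v -> (q.1 + q.2 < M)%N.
  by move=> qv; rewrite /M (big_rem q) //= leq_max leqnn.
have comp0 J q : (q.1 + q.2 < J)%N -> psi J (projection J << q >>) = 0.
  case: q => i j /= ltJ; rewrite projectionU q3j_pi_out; last by lia.
  by rewrite scale0r (raddf0 (psi J)).
rewrite (fsum_lt (M := M)); last first.
  move=> J MJ; apply: (@linear_supp_eq0 C _ _ (psi J \o projection J)) => q qv.
  by apply: comp0; apply: leq_trans (ltM q qv) MJ.
apply: (@sum_linear_supp_id C _ (fun J => psi J \o projection J)) => q qv.
have qM := ltM q qv.
(* The bound M is common to the whole support; for a single basis vector only J <= q.1 + q.2
   contributes. *)
rewrite (big_cat_nat (n := (q.1 + q.2).+1)) //=.
rewrite [X in _ + X]big_nat [X in _ + X]big1 ?addr0; last first.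
  by move=> J /andP[J_q _]; apply: comp0.
by case: q {qv qM} => i j; apply: psi_projection_basis.
Qed.

Lemma orthogonality_sum J J' k k' :
  \sum_(q \in [set: nat * nat]) p J q.1 q.2 k * c J' q.1 q.2 k' =
  ((J == J') && (k == k'))%:R.
Proof.
(* The two symbols live on the diagonals of total J + k and J' + k'; distinct totals make every
   product zero, and equal totals leave one weight space. *)
have [e|ne] := eqVneq (J + k)%N (J' + k')%N; last first.
  have -> : (J == J') && (k == k') = false.
    by apply/negbTE; apply: contraNN ne => /andP[/eqP -> /eqP ->].
  apply: fsbig1 => q _; have [e|ne'] := eqVneq (q.1 + q.2)%N (J + k)%N.
    by rewrite [c _ _ _ _]q3j_psi_out ?mulr0 // e.
  by rewrite q3j_pi_out ?mul0r.
rewrite (fsum_diag (N := (J + k)%N)); last first.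
  by move=> q ne; rewrite q3j_pi_out ?mul0r.
have leJ' : (J' <= J + k)%N by lia.
have := orthogonality (leq_addr k J) leJ'.
have -> : (J + k - J' = k')%N by lia.
rewrite addKn => ->; congr (nat_of_bool _)%:R.
by apply/eqP/andP => [JJ'|[/eqP ->]] //; split; apply/eqP; lia.
Qed.

Lemma completeness_sum k1 k2 k1' k2' :
  \sum_(q \in [set: nat * nat]) p q.1 k1 k2 q.2 * c q.1 k1' k2' q.2 =
  ((k1 == k1') && (k2 == k2'))%:R.
Proof.
(* Now the diagonal lies in the pairs (J, k), of total k1 + k2 for one symbol and k1' + k2' for the
   other. *)
have [e|ne] := eqVneq (k1 + k2)%N (k1' + k2')%N; last first.
  have -> : (k1 == k1') && (k2 == k2') = false.
    by apply/negbTE; apply: contraNN ne => /andP[/eqP -> /eqP ->].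
  apply: fsbig1 => q _; have [e|ne'] := eqVneq (k1 + k2)%N (q.1 + q.2)%N.
    by rewrite [c _ _ _ _]q3j_psi_out ?mulr0 // -e eq_sym.
  by rewrite q3j_pi_out ?mul0r.
rewrite (fsum_diag (N := (k1 + k2)%N)); last first.
  by move=> q ne; rewrite q3j_pi_out ?mul0r // eq_sym.
have le1 : (k1' <= k1 + k2)%N by lia.
have := completeness (leq_addr k2 k1) le1.
have -> : (k1 + k2 - k1' = k2')%N by lia.
rewrite addKn => ->; congr (nat_of_bool _)%:R.
by apply/eqP/andP => [k11|[/eqP ->]] //; split; apply/eqP; lia.
Qed.

End Orthogonality.

Theorem theorem4p2 (R : realType) (h l1 l2 : R[i]) (Delta : nat -> R[i])
    (q_gen : q_generic h l1 l2)
    (l1_gen : not_half_nat l1) (l2_gen : not_half_nat l2)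
    (l12_gen : not_half_nat (l1 + l2))
    (DeltaE : forall J : nat, Delta J ^+ 2 = triangle_sq h l1 l2 J) :
  (forall J : nat,
     uq_hom (tensor (verma h l1) (verma h l2)) (verma h (l1 + l2 - J%:R))
            (projection h l1 l2 Delta J)) /\
  (forall (J : nat) (v : {malg R[i][nat]}),
     projection h l1 l2 Delta J (psi h l1 l2 Delta J v) = v) /\
  (forall v : {malg R[i][(nat * nat)%type]},
     \sum_(J \in [set: nat])
        psi h l1 l2 Delta J (projection h l1 l2 Delta J v) = v) /\
  (forall J J' k k' : nat,
     \sum_(p \in [set: nat * nat])
        q3j_pi h l1 l2 Delta J p.1 p.2 k * q3j_psi h l1 l2 Delta J' p.1 p.2 k'
     = ((J == J') && (k == k'))%:R) /\
  (forall k1 k2 k1' k2' : nat,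
     \sum_(p \in [set: nat * nat])
        q3j_pi h l1 l2 Delta p.1 k1 k2 p.2 *
        q3j_psi h l1 l2 Delta p.1 k1' k2' p.2
     = ((k1 == k1') && (k2 == k2'))%:R).
Proof.
split; first exact: projection_hom.
split; first by move=> J; exact: projection_psi.
split; first exact: psi_projection.
split; first exact: orthogonality_sum.
exact: completeness_sum.
Qed.
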